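(* Let $n\ge2$, let $\Omega\subset\mathbb{R}^n$ be a bounded convex domain, and let $0\le\alpha<2$, $p>0$, and $M>0$. Let $u\in C(\overline\Omega)$ be a nonzero convex solution to $$\mu_u=M|u|^p\operatorname{dist}(\cdot,\partial\Omega)^{-\alpha}\,d\mathcal{L}^n\quad\text{in }\Omega,\qquad u=0\quad\text{on }\partial\Omega.$$ (i) If $p-\alpha>(\alpha-1)n-2$, then $I[u]<\infty$. (ii) If $p-\alpha\le(\alpha-1)n-2$ and there is a closed subset $\Gamma\subset\partial\Omega$ lying in a hyperplane and containing an $(n-1)$-dimensional ball of positive radius, then $I[u]=\infty$.
   Context: For a convex function $u$ on a convex domain $\Omega\subset\mathbb{R}^n$, the subdifferential at $x\in\Omega$ is $\partial u(x)=\{q\in\mathbb{R}^n: u(y)\ge u(x)+q\cdot(y-x)\ \text{for all }y\in\Omega\}$, and the Monge--Ampère measure of $u$ is $\mu_u(E)=|\bigcup_{x\in E}\partial u(x)|$ for Borel $E\subset\Omega$. $\mathcal{L}^n$ is $n$-dimensional Lebesgue measure. The Monge--Ampère energy of a convex function $u\in C(\overline\Omega)$ with zero boundary values is $I[u]=\int_\Omega|u|\,d\mu_u\in[0,\infty]$. *)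

(* Defs.v *)
From mathcomp Require Import all_boot all_order all_algebra.
From mathcomp Require Import all_classical all_reals all_analysis.

Set Implicit Arguments.
Unset Strict Implicit.
Unset Printing Implicit Defensive.

Import Order.TTheory GRing.Theory Num.Theory.
Import numFieldNormedType.Exports.

Local Open Scope classical_set_scope.
Local Open Scope ring_scope.

(* R^n is 'rV[R]_n.  Its library norm is the sup norm, which yields the usual
   topology and bounded sets but not the Euclidean distance, hence [enorm]. *)

Definition dotv (R : realType) (n : nat) (x y : 'rV[R]_n) : R :=
  \sum_(i < n) x 0 i * y 0 i.

Definition enorm (R : realType) (n : nat) (x : 'rV[R]_n) : R :=
  Num.sqrt (dotv x x).

Definition boundary (T : topologicalType) (A : set T) : set T :=
  closure A `\` interior A.

Definition euclid_dist (R : realType) (n : nat) (x : 'rV[R]_n)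
    (A : set 'rV[R]_n) : R :=
  inf [set enorm (x - y) | y in A].

Definition borel_rV (R : realType) (n : nat) :=
  g_sigma_algebraType (@open 'rV[R]_n).

(* Half-open boxes ]a, b], with a and b the components of [ab]. *)
Definition box (R : realType) (n : nat) (ab : 'rV[R]_n * 'rV[R]_n) :
    set 'rV[R]_n :=
  [set x | forall i, ab.1 0 i < x 0 i <= ab.2 0 i].

Definition box_volume (R : realType) (n : nat) (ab : 'rV[R]_n * 'rV[R]_n) : R :=
  \prod_(i < n) (ab.2 0 i - ab.1 0 i).

Definition box_cover (R : realType) (n : nat) (A : set 'rV[R]_n) :
    set (nat -> 'rV[R]_n * 'rV[R]_n) :=
  [set F : nat -> 'rV[R]_n * 'rV[R]_n |
    (forall k i, (F k).1 0 i <= (F k).2 0 i) /\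
    A `<=` \bigcup_k box (F k)].

(* The n-dimensional Lebesgue measure (n >= 1), as an outer measure: it has the
   right value on every Lebesgue-measurable set, which matters below since the
   image of a Borel set under a subdifferential need not be Borel. *)
Definition lebesgue_rV (R : realType) (n : nat) :
    set (borel_rV R n) -> \bar R :=
  fun A => ereal_inf
    [set (\sum_(0 <= k <oo) (box_volume (F k))%:E)%E | F in box_cover A].

Definition subdifferential (R : realType) (n : nat) (Omega : set 'rV[R]_n)
    (u : 'rV[R]_n -> R) (x : 'rV[R]_n) : set 'rV[R]_n :=
  [set q | forall y, Omega y -> u x + dotv q (y - x) <= u y].

(* Extended to all of R^n so as to be carried by Omega. *)
Definition monge_ampere (R : realType) (n : nat) (Omega : set 'rV[R]_n)
    (u : 'rV[R]_n -> R) : set (borel_rV R n) -> \bar R :=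
  fun E => lebesgue_rV (\bigcup_(x in E `&` Omega) subdifferential Omega u x).

Definition ma_energy (R : realType) (n : nat) (Omega : set 'rV[R]_n)
    (u : 'rV[R]_n -> R) : \bar R :=
  (\int[monge_ampere Omega u]_(x in Omega) `|u x|%:E)%E.

Definition convex_domain (R : realType) (n : nat) (Omega : set 'rV[R]_n) :=
  [/\ open Omega, Omega !=set0 & convex_set Omega].

Definition ma_equation (R : realType) (n : nat) (Omega : set 'rV[R]_n)
    (M p alpha : R) (u : 'rV[R]_n -> R) :=
  forall E : set (borel_rV R n), measurable E -> E `<=` Omega ->
    monge_ampere Omega u E =
    (\int[@lebesgue_rV R n]_(x in E)
      (M * `|u x| `^ p * euclid_dist x (boundary Omega) `^ (- alpha))%:E)%E.

Definition is_hyperplane (R : realType) (n : nat) (H : set 'rV[R]_n) :=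
  exists (a : 'rV[R]_n) (b : R), a != 0 /\ H = [set x | dotv a x = b].

Definition is_flat_ball (R : realType) (n : nat) (B : set 'rV[R]_n) :=
  exists (H : set 'rV[R]_n) (c : 'rV[R]_n) (r : R),
    [/\ is_hyperplane H, H c, 0 < r &
        B = H `&` [set x | enorm (x - c) < r]].

(* Main.v *)
Require Import Defs.
From mathcomp Require Import all_boot all_order all_algebra.
From mathcomp Require Import all_classical all_reals all_analysis.
From mathcomp Require Import measurable_realfun ring lra.
From HB Require Import structures.

Set Implicit Arguments.
Unset Strict Implicit.
Unset Printing Implicit Defensive.

Import Order.TTheory GRing.Theory Num.Theory.
Import numFieldNormedType.Exports.

Local Open Scope classical_set_scope.
Local Open Scope ring_scope.

(** Write [N] for the dimension, [d(x)] for the distance from [x] to the boundary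
    and [A ~ B] when [A] and [B] are bounded by constant multiples of each other.
    Both parts compare, on sets adapted to the boundary, the Lebesgue volume of a
    set of slopes of [u] with the mass that the equation gives to the points
    where these slopes occur.

    Finite energy. If [|u| <= K d^g], the mass density of the Monge-Ampere measure
    is [O(d^(p g - alpha))]. The barrier [w = - K (C - |x|^2) d^b], [0 < b < 1],
    vanishes on the boundary. If [u - w] had a negative minimum, at [x0] say, then
    [u] would lie above a paraboloid touching it at [x0], with second derivatives
    of order [K d^(b-2)] in the direction [e] of the nearest boundary point, and
    [K d^b] in the others ([support_dist], [barrier_upper_bound]). So
    [u] has, in a cylinder about [x0] of length [~ d^2] along [e] and radius
    [~ d], all the slopes of a cylinder of length [~ K d^b] and radius
    [~ K d^(b+1)] ([tube_subdifferential]). Comparing volumes,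
    [K^N d^(N b) = O(d^(p g - alpha + 2))], which is absurd for large [K] as soon
    as [N b <= p g - alpha + 2] ([touching_paraboloid_bound], [decay_improve]). Thus
    the exponent [g] of the decay improves to [(p g - alpha + 2) / N], and
    [p - alpha > (alpha - 1) N - 2] says exactly that this is more than [g] at
    [g = (alpha - 1) / (p + 1)]. Starting from [g = 0], finitely many
    improvements reach [g (p + 1) > alpha - 1] ([decay_supercritical]). The layer
    [d ~ t] has volume [O(t)] by convexity ([boundary_layer_volume]), hence energy
    [O(t^(g + p g - alpha + 1))], and the sum over dyadic [t] converges
    ([decay_energy_finite]).

    Infinite energy. Near the flat part [Omega] contains a cylinder standing on it
    ([flat_cylinder]). In the slab of this cylinder between the heights [t] and
    [2 t], the concave function [|u|] is comparable to its value [A] at the axis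
    ([slab_harnack]), its slopes are [O(A / t)] along the axis and [O(A)] across
    ([slab_subdifferential]), and [d <= 2 t]. Comparing the mass
    [~ A^p t^(1 - alpha)] with the volume [O(A^N / t)] of the slopes yields
    [A^(N - p) >= k t^(2 - alpha)], so that the energy [~ A^(p + 1) t^(1 - alpha)]
    of the slab is at least a power of [t] whose exponent is nonpositive exactly
    when [p - alpha <= (alpha - 1) N - 2] ([slab_energy]). Infinitely many
    disjoint slabs contribute at least a fixed amount each.

    These arguments need Lebesgue measure as a measure on Borel sets, translation
    invariant and homogeneous, with cylinders of the expected volume up to
    constants that do not depend on their direction ([borel_caratheodory], [cyl_volume]); and
    integrals against the Monge-Ampere measure, which the equation makes
    countably additive ([monge_ampere_measure]). *)

(** * Euclidean geometry of row vectors *)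

Lemma lip_continuous {R : realType} {V : normedModType R} (f : V -> R) K :
  (forall x y, `|f x - f y| <= K * `|x - y|) -> continuous f.
Proof.
move=> H x; apply/cvgrPdist_lt => e e0; near=> y.
have K0 : 0 < `|K| + 1 by rewrite ltr_wpDl.
apply: le_lt_trans (H x y) _.
apply: (@le_lt_trans _ _ ((`|K| + 1) * `|x - y|)).
  by rewrite ler_wpM2r// (le_trans (ler_norm _))// lerDl.
rewrite mulrC -ltr_pdivlMr//; near: y.
by apply: cvgr_dist_lt; rewrite // divr_gt0.
Unshelve. all: by end_near. Qed.

Section Euclid.
Context {R : realType} {n : nat}.
Implicit Types (x y z : 'rV[R]_n) (c : R).

Lemma dotvC x y : dotv x y = dotv y x.
Proof. by apply: eq_bigr => i _; rewrite mulrC. Qed.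

Lemma dotvDl x y z : dotv (x + y) z = dotv x z + dotv y z.
Proof. by rewrite -big_split; apply: eq_bigr => i _; rewrite mxE mulrDl. Qed.

Lemma dotvZl c x y : dotv (c *: x) y = c * dotv x y.
Proof. by rewrite mulr_sumr; apply: eq_bigr => i _; rewrite mxE mulrA. Qed.

Lemma dotvDr x y z : dotv z (x + y) = dotv z x + dotv z y.
Proof. by rewrite dotvC dotvDl !(dotvC z). Qed.

Lemma dotvZr c x y : dotv x (c *: y) = c * dotv x y.
Proof. by rewrite dotvC dotvZl dotvC. Qed.

Lemma dotvNl x y : dotv (- x) y = - dotv x y.
Proof. by rewrite -scaleN1r dotvZl mulN1r. Qed.

Lemma dotvNr x y : dotv x (- y) = - dotv x y.
Proof. by rewrite dotvC dotvNl dotvC. Qed.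

Lemma dotvBl x y z : dotv (x - y) z = dotv x z - dotv y z.
Proof. by rewrite dotvDl dotvNl. Qed.

Lemma dotvBr x y z : dotv z (x - y) = dotv z x - dotv z y.
Proof. by rewrite dotvDr dotvNr. Qed.

Lemma dotv0r x : dotv x 0 = 0.
Proof. by rewrite -(scale0r x) dotvZr mul0r. Qed.

Lemma dotv0l x : dotv 0 x = 0.
Proof. by rewrite dotvC dotv0r. Qed.

Lemma dotv_ge0 x : 0 <= dotv x x.
Proof. by apply: sumr_ge0 => i _; rewrite -expr2 sqr_ge0. Qed.

Lemma enorm_ge0 x : 0 <= enorm x.
Proof. exact: sqrtr_ge0. Qed.

Lemma sqr_enorm x : enorm x ^+ 2 = dotv x x.
Proof. by rewrite sqr_sqrtr// dotv_ge0. Qed.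

Lemma enormE x : enorm x * enorm x = dotv x x.
Proof. by rewrite -expr2 sqr_enorm. Qed.

Lemma enorm0 : enorm (0 : 'rV[R]_n) = 0.
Proof. by rewrite /enorm dotv0r sqrtr0. Qed.

Lemma enormZ c x : enorm (c *: x) = `|c| * enorm x.
Proof.
by rewrite /enorm dotvZl dotvZr mulrA -expr2 sqrtrM ?sqr_ge0// sqrtr_sqr.
Qed.

Lemma enormN x : enorm (- x) = enorm x.
Proof. by rewrite -scaleN1r enormZ normrN1 mul1r. Qed.

Lemma enormB x y : enorm (x - y) = enorm (y - x).
Proof. by rewrite -enormN opprB. Qed.

Lemma norm_dotv_le x y : `|dotv x y| <= enorm x * enorm y.
Proof.
rewrite -(@ler_pXn2r _ 2)// ?nnegrE ?mulr_ge0 ?enorm_ge0//.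
rewrite exprMn !sqr_enorm real_normK ?num_real//.
have [y0|y0] := eqVneq (dotv y y) 0.
  have y00 : y = 0.
    apply/rowP => i; rewrite mxE.
    have /psumr_eq0P := y0.
    move=> /(_ (fun i _ => sqr_ge0 (y 0 i))) /(_ i isT)/eqP.
    by rewrite mulf_eq0 orbb => /eqP.
  by rewrite y00 !dotv0r expr0n mulr0.
have yp : 0 < dotv y y by rewrite lt_def y0 dotv_ge0.
have := dotv_ge0 (dotv y y *: x - dotv x y *: y).
rewrite dotvBl !dotvBr !dotvZl !dotvZr (dotvC y x) => H.
have : 0 <= dotv y y * (dotv x x * dotv y y - dotv x y ^+ 2).
  by apply: le_trans H _; rewrite le_eqVlt; apply/orP; left; apply/eqP; ring.
by rewrite pmulr_rge0// subr_ge0.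
Qed.

Lemma dotv_le x y : dotv x y <= enorm x * enorm y.
Proof. exact: le_trans (ler_norm _) (norm_dotv_le _ _). Qed.

Lemma enormD x y : enorm (x + y) <= enorm x + enorm y.
Proof.
rewrite -(@ler_pXn2r _ 2)// ?nnegrE ?addr_ge0 ?enorm_ge0//.
rewrite sqrrD !sqr_enorm dotvDl !dotvDr (dotvC y x).
have := dotv_le x y; lra.
Qed.

Lemma sqr_enormD x y :
  enorm (x + y) ^+ 2 = enorm x ^+ 2 + 2 * dotv x y + enorm y ^+ 2.
Proof. by rewrite !sqr_enorm dotvDl !dotvDr (dotvC y x); ring. Qed.

Lemma enorm_eq0 x : enorm x = 0 -> x = 0.
Proof.
move=> x0; have /psumr_eq0P : dotv x x = 0 by rewrite -enormE x0 mul0r.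
move=> /(_ (fun i _ => sqr_ge0 (x 0 i))) H.
apply/rowP => i; rewrite mxE; have /eqP := H i isT.
by rewrite mulf_eq0 orbb => /eqP.
Qed.

Lemma enorm_gt0 x : x != 0 -> 0 < enorm x.
Proof.
move=> x0; rewrite lt_def enorm_ge0 andbT.
by apply: contra_neq x0 => /enorm_eq0.
Qed.

Lemma coord_le_enorm x i : `|x 0 i| <= enorm x.
Proof.
rewrite -(@ler_pXn2r _ 2)// ?nnegrE ?enorm_ge0// sqr_enorm.
rewrite real_normK ?num_real// /dotv (bigD1 i)//= -expr2 lerDl.
by apply: sumr_ge0 => j _; rewrite -expr2 sqr_ge0.
Qed.

Lemma coord_le_norm x i : `|x 0 i| <= `|x|.
Proof.
rewrite [leRHS]/Num.norm /= mx_normrE; apply/bigmax_geP; right.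
by exists (0, i).
Qed.

Lemma norm_le_coord x c : 0 <= c -> (forall i, `|x 0 i| <= c) -> `|x| <= c.
Proof.
move=> c0 H; rewrite [leLHS]/Num.norm /= mx_normrE; apply/bigmax_leP; split => //.
by move=> [i j] _ /=; rewrite (ord1 i).
Qed.

Lemma norm_le_enorm x : `|x| <= enorm x.
Proof. by apply: norm_le_coord (enorm_ge0 _) _ => i; exact: coord_le_enorm. Qed.

Lemma enorm_le_norm x : enorm x <= n%:R * `|x|.
Proof.
rewrite -(@ler_pXn2r _ 2)// ?nnegrE ?mulr_ge0 ?enorm_ge0// sqr_enorm exprMn.
apply: (@le_trans _ _ (n%:R * `|x| ^+ 2)).
  rewrite mulr_natl -[X in _ *+ X](card_ord n) -sumr_const.
  apply: ler_sum => i _; rewrite -expr2 -real_normK ?num_real//.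
  by rewrite lerXn2r ?nnegrE// coord_le_norm.
rewrite ler_wpM2r ?sqr_ge0// -natrX ler_nat.
by case: (n) => // m; rewrite expnS expn1 leq_pmull.
Qed.

Definition perp (e x : 'rV[R]_n) := x - dotv x e *: e.

Lemma perpD e x y : perp e (x + y) = perp e x + perp e y.
Proof. by rewrite /perp dotvDl scalerDl opprD addrACA. Qed.

Lemma perpZ e c x : perp e (c *: x) = c *: perp e x.
Proof. by rewrite /perp dotvZl -scalerA scalerBr. Qed.

Lemma perpN e x : perp e (- x) = - perp e x.
Proof. by rewrite -scaleN1r perpZ scaleN1r. Qed.

Lemma perpB e x y : perp e (x - y) = perp e x - perp e y.
Proof. by rewrite perpD perpN. Qed.

Lemma perpK e x : x = dotv x e *: e + perp e x.
Proof. by rewrite /perp addrC subrK. Qed.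

Section unit.
Variable e : 'rV[R]_n.
Hypothesis e1 : enorm e = 1.

Lemma dotv_unit : dotv e e = 1.
Proof. by rewrite -enormE e1 mul1r. Qed.

Lemma perp_unit : perp e e = 0.
Proof. by rewrite /perp dotv_unit scale1r subrr. Qed.

Lemma dotv_perp x : dotv (perp e x) e = 0.
Proof. by rewrite /perp dotvBl dotvZl dotv_unit mulr1 subrr. Qed.

Lemma sqr_enorm_perp x : enorm x ^+ 2 = dotv x e ^+ 2 + enorm (perp e x) ^+ 2.
Proof.
have h := dotv_perp x; rewrite {1}(perpK e x) !sqr_enorm.
move: (perp e x) h => y h.
rewrite dotvDl !dotvDr !dotvZl !dotvZr dotv_unit h [dotv e y]dotvC h.
by ring.
Qed.

Lemma enorm_perp_le x : enorm (perp e x) <= enorm x.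
Proof.
rewrite -(@ler_pXn2r _ 2)// ?nnegrE ?enorm_ge0//.
by rewrite [leRHS]sqr_enorm_perp lerDr sqr_ge0.
Qed.

Lemma norm_dotv_unit_le x : `|dotv x e| <= enorm x.
Proof. by rewrite -[leRHS]mulr1 -e1 norm_dotv_le. Qed.

Lemma enorm_le_perp x : enorm x <= `|dotv x e| + enorm (perp e x).
Proof.
by rewrite {1}(perpK e x) (le_trans (enormD _ _))// enormZ e1 mulr1.
Qed.

Lemma dotv_splitE x y :
  dotv x y = dotv x e * dotv y e + dotv (perp e x) (perp e y).
Proof.
have hx := dotv_perp x; have hy := dotv_perp y.
rewrite {1}(perpK e x) {1}(perpK e y).
move: (perp e x) (perp e y) hx hy => x' y' hx hy.
rewrite dotvDl !dotvDr !dotvZl !dotvZr dotv_unit hx [dotv e y']dotvC hy.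
by ring.
Qed.

End unit.

Lemma enorm_lip x y : `|enorm x - enorm y| <= enorm (x - y).
Proof.
have h1 := enormD (x - y) y; have h2 := enormD (y - x) x.
rewrite !subrK (enormB y) in h1 h2.
by rewrite ler_norml; apply/andP; split; lra.
Qed.

Lemma enorm_lip_continuous (f : 'rV[R]_n -> R) K :
  (forall x y, `|f x - f y| <= K * enorm (x - y)) -> continuous f.
Proof.
move=> H; apply: (@lip_continuous _ _ f (`|K| * n%:R)) => x y.
apply: le_trans (H x y) _; rewrite -mulrA.
apply: (le_trans (ler_wpM2r (enorm_ge0 _) (ler_norm K))).
by rewrite ler_wpM2l// enorm_le_norm.
Qed.

Lemma dotv_continuous x : continuous (fun y => dotv y x).
Proof.
apply: (@enorm_lip_continuous _ (enorm x)) => y z.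
by rewrite -dotvBl mulrC norm_dotv_le.
Qed.

Lemma enorm_continuous : continuous (@enorm R n).
Proof.
by apply: (@enorm_lip_continuous _ 1) => y z; rewrite mul1r enorm_lip.
Qed.

End Euclid.

(** * Lebesgue outer measure *)

Section LebesgueOuter.
Context {R : realType} {n : nat}.
Local Notation V := 'rV[R]_n.+1.
Local Notation lam := (@lebesgue_rV R n.+1).
Implicit Types A B X : set V.

Lemma box_volume_ge0 (ab : V * V) :
  (forall i, ab.1 0 i <= ab.2 0 i) -> 0 <= box_volume ab.
Proof. by move=> H; apply: prodr_ge0 => i _; rewrite subr_ge0. Qed.

Lemma lebesgue_rV_ge0 A : (0 <= lam A)%E.
Proof.
apply: le_ereal_inf_tmp => _ [F [F1 _] <-].
by apply: nneseries_ge0 => k _ _; rewrite lee_fin box_volume_ge0.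
Qed.

Lemma lebesgue_rV0 : lam set0 = 0%E.
Proof.
apply/eqP; rewrite eq_le lebesgue_rV_ge0 andbT.
apply: ereal_inf_lbound; exists (fun=> (0, 0)); first by split => // k i /=.
rewrite eseries0// => k _ _.
by rewrite /box_volume big_ord_recl /= subrr mul0r.
Qed.

Lemma le_lebesgue_rV : {homo lam : A B / A `<=` B >-> (A <= B)%E}.
Proof.
move=> A B AB; apply: le_ereal_inf_tmp => _ [F [F1 F2] <-].
apply: ereal_inf_lbound; exists F => //; split => //.
exact: subset_trans F2.
Qed.

(** Covers of the [A k] whose excesses [e / 2 ^ k.+1] sum to [e] merge into one
    cover of the union, reindexed along a bijection of [nat] with its square. *)
Lemma lebesgue_rV_sigma_subadditive : sigma_subadditive lam.
Proof.
move=> A; have [[i ioo]|] := pselect (exists i, lam (A i) = +oo%E).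
  rewrite (eseries_pinfty _ _ ioo) ?leey// => k _.
  by rewrite -ltNye (lt_le_trans _ (lebesgue_rV_ge0 _)).
rewrite -forallNE => Aoo.
suff add2e (e : {posnum R}) :
    (lam (\bigcup_k A k) <= \sum_(i <oo) lam (A i) + e%:num%:E)%E.
  by apply/lee_addgt0Pr => _/posnumP[].
rewrite (le_trans _ (epsilon_trick _ _ _))//; last first.
  by move=> k; exact: lebesgue_rV_ge0.
pose P k (B : nat -> V * V) := box_cover (A k) B /\
  (\sum_(j <oo) (box_volume (B j))%:E <=
   lam (A k) + (e%:num / (2 ^ k.+1)%:R)%:E)%E.
have [G PG] : {G : nat -> nat -> V * V & forall k, P k (G k)}.
  apply: (@choice _ _ P) => k; rewrite /P.
  have fk : lam (A k) \is a fin_num.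
    by rewrite ge0_fin_numE ?lebesgue_rV_ge0// ltey; apply/eqP/Aoo.
  have en1 : 0 < e%:num / (2 ^ k.+1)%:R by [].
  have [_ [B HB <-] lt] := lb_ereal_inf_adherent en1 fk.
  by exists B; split => //; exact: ltW.
pose w (ij : nat * nat) : \bar R := (box_volume (G ij.1 ij.2))%:E.
have w0 ij : (0 <= w ij)%E by rewrite lee_fin box_volume_ge0// => i; exact: (PG ij.1).1.1.
apply: (@le_trans _ _ (\esum_(i in setT) w i)%E).
  apply: ereal_inf_lbound => /=.
  have /card_esym/ppcard_eqP[f] := card_nat2.
  exists (fun k => G (f k).1 (f k).2).
    split => [k i|]; first exact: (PG _).1.1.
    move=> t [i _ Ait]; have [j _ Bijt] := (PG i).1.2 _ Ait.
    by exists (f^-1%FUN (i, j)) => //=; rewrite invK ?inE.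
  rewrite nneseries_esumT; last by move=> k; exact: (w0 (f k)).
  by rewrite [RHS](reindex_esum setT setT f).
have -> : (\esum_(i in setT) w i = \sum_(i <oo) \sum_(j <oo) w (i, j))%E.
  rewrite nneseries_esumT; last by move=> i; exact: nneseries_ge0.
  under [RHS]eq_esum do rewrite nneseries_esumT//.
  rewrite (@esum_esum _ _ _ setT (fun=> setT) (fun i j => w (i, j)))//.
  have -> : [set: nat] `*`` (fun=> [set: nat]) = [set: nat * nat].
    by apply/seteqP; split.
  by apply: eq_esum => -[].
apply: lee_nneseries => [i _ _|i _]; first exact: nneseries_ge0.
exact: (PG i).2.
Qed.

HB.instance Definition _ := isOuterMeasure.Build R (borel_rV R n.+1) lam
  lebesgue_rV0 lebesgue_rV_ge0 le_lebesgue_rV lebesgue_rV_sigma_subadditive.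

(** A hyperplane orthogonal to an axis cuts each box of a cover into two boxes of
    the same total volume, which sort into covers of the two sides. *)
Lemma halfspace_caratheodory (i : 'I_n.+1) (c : R) :
  caratheodory_measurable lam [set x : V | x 0 i <= c].
Proof.
apply: (@le_caratheodory_measurable _ _ lam) => X.
apply: le_ereal_inf_tmp => _ [F [F1 F2] <-].
(* The cut of the box [F k], clipped to the box: one of the two pieces is empty
   when the hyperplane misses the box. *)
pose m k := Num.max ((F k).1 0 i) (Num.min ((F k).2 0 i) c).
have m1 k : (F k).1 0 i <= m k by rewrite le_max lexx.
have m2 k : m k <= (F k).2 0 i by rewrite ge_max F1 ge_min lexx.
pose upd (v : V) t : V := \row_j (if j == i then t else v 0 j).
pose G1 k := ((F k).1, upd (F k).2 (m k)).
pose G2 k := (upd (F k).1 (m k), (F k).2).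
have o1 k j : (G1 k).1 0 j <= (G1 k).2 0 j.
  by rewrite /= mxE; case: eqP => [->|_]; rewrite ?m1.
have o2 k j : (G2 k).1 0 j <= (G2 k).2 0 j.
  by rewrite /= mxE; case: eqP => [->|_]; rewrite ?m2.
have vol k : (box_volume (F k))%:E =
    ((box_volume (G1 k))%:E + (box_volume (G2 k))%:E)%E.
  rewrite -EFinD; congr EFin; rewrite /box_volume [LHS](bigD1 i)//=.
  rewrite [X in _ = X + _](bigD1 i)//= [X in _ = _ + X](bigD1 i)//=.
  rewrite !mxE eqxx.
  rewrite [X in _ = _ * X + _](eq_bigr (fun j => (F k).2 0 j - (F k).1 0 j)); last first.
    by move=> j ji; rewrite !mxE (negbTE ji).
  rewrite [X in _ = _ + _ * X](eq_bigr (fun j => (F k).2 0 j - (F k).1 0 j)); last first.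
    by move=> j ji; rewrite !mxE (negbTE ji).
  by rewrite -mulrDl; congr (_ * _); ring.
under [leRHS]eq_eseriesr do rewrite vol.
rewrite nneseriesD; first last.
- by move=> k _; rewrite lee_fin box_volume_ge0.
- by move=> k _; rewrite lee_fin box_volume_ge0.
apply: leeD; apply: ereal_inf_lbound.
- exists G1 => //; split => // x [Xx /= xc].
  have [k _ Bk] := F2 _ Xx; exists k => // j /=; rewrite mxE.
  have /andP[l r] := Bk j; case: eqP => [ji|_]; last by rewrite l.
  by rewrite -ji in xc *; rewrite l /m -ji le_max le_min r xc orbT.
- exists G2 => //; split => // x [Xx /= /negP]; rewrite -ltNge => xc.
  have [k _ Bk] := F2 _ Xx; exists k => // j /=; rewrite mxE.
  have /andP[l r] := Bk j; case: eqP => [ji|_]; last by rewrite l.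
  by rewrite -ji in xc *; rewrite r /m -ji gt_max gt_min l xc orbT.
Qed.

Lemma box_caratheodory (ab : V * V) : caratheodory_measurable lam (box ab).
Proof.
(* The finite intersection over the coordinates is the complement of a union
   indexed by [nat], with empty terms past the dimension. *)
pose D (k : nat) : set V := if insub k is Some i then
  ~` ([set x : V | x 0 i <= ab.2 0 i] `\` [set x : V | x 0 i <= ab.1 0 i])
  else set0.
have -> : box ab = ~` (\bigcup_k D k).
  rewrite setC_bigcup; apply/seteqP; split => x H.
    move=> k _; rewrite /D; case: insubP => [i _ _|_]; last by [].
    rewrite setCK.
    by have /andP[l r] := H i; split => //=; apply/negP; rewrite -ltNge.
  move=> i; have := H i I; rewrite /D valK setCK => -[/= l /negP].
  by rewrite -ltNge => ->.
apply: (@caratheodory_measurable_setC _ _ lam).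
apply: (@caratheodory_measurable_bigcup _ _ lam) => k; rewrite /D.
case: insubP => [i _ _|_]; last exact: (@caratheodory_measurable_set0 _ _ lam).
apply: (@caratheodory_measurable_setC _ _ lam).
by apply: (@caratheodory_measurable_setD _ _ lam); exact: halfspace_caratheodory.
Qed.

(** An open set is the union of the countably many boxes with rational vertices
    that it contains. *)
Lemma open_caratheodory (U : set V) : open U -> caratheodory_measurable lam U.
Proof.
move=> oU.
pose rbox (q : 'rV[rat]_n.+1 * 'rV[rat]_n.+1) : set V :=
  box (map_mx ratr q.1, map_mx ratr q.2).
pose D (k : nat) : set V :=
  if unpickle k is Some q then (if `[< rbox q `<=` U >] then rbox q else set0)
  else set0.
have -> : U = \bigcup_k D k; last first.
  apply: (@caratheodory_measurable_bigcup _ _ lam) => k; rewrite /D.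
  case: unpickle => [q|]; last exact: (@caratheodory_measurable_set0 _ _ lam).
  case: ifP => _; [exact: box_caratheodory|].
  exact: (@caratheodory_measurable_set0 _ _ lam).
apply/seteqP; split => x; last first.
  move=> [k _]; rewrite /D; case: unpickle => // q.
  by case: ifPn => // /asboolP; apply.
move=> Ux; have /nbhs_ballP[e /= e0 xe] := open_nbhs_nbhs (conj oU Ux).
have qa (i : 'I_n.+1) : exists q : rat, ratr q \in `]x 0 i - e, x 0 i[.
  by apply: rat_in_itvoo; rewrite ltrBlDr ltrDl.
have qb (i : 'I_n.+1) : exists q : rat, ratr q \in `]x 0 i, x 0 i + e[.
  by apply: rat_in_itvoo; rewrite ltrDl.
have [a Ha] := choice qa; have [b Hb] := choice qb.
pose q := (\row_i a i, \row_i b i).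
exists (pickle q) => //; rewrite /D pickleK ifT.
  move=> i; rewrite !mxE.
  move: (Ha i) (Hb i); rewrite !in_itv /= => /andP[_ ->] /andP[lb _].
  by rewrite ltW.
apply/asboolP => y yq; apply: xe; rewrite -ball_normE /=.
have [E [E0 Ee HE]] : exists E, [/\ 0 <= E, E < e & forall i, `|(x - y) 0 i| <= E].
  pose f i := `|(x - y) 0 i|.
  exists (\big[Num.max/0]_i f i); split.
  - by apply: bigmax_ge_id.
  - apply/bigmax_ltP; split => // i _; rewrite /f !mxE ltr_norml.
    have := yq i; rewrite !mxE.
    move: (Ha i) (Hb i); rewrite !in_itv /= => /andP[h1 h2] /andP[h3 h4] /andP[h5 h6].
    by apply/andP; split; lra.
  - by move=> i; rewrite /f; apply: le_bigmax.
by apply: le_lt_trans Ee; exact: norm_le_coord.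
Qed.

Lemma borel_caratheodory (E : set (borel_rV R n.+1)) :
  measurable E -> caratheodory_measurable lam E.
Proof.
apply: smallest_sub; last by move=> U; exact: open_caratheodory.
split.
- exact: (@caratheodory_measurable_set0 _ _ lam).
- move=> A mA; rewrite setTD.
  exact: (@caratheodory_measurable_setC _ _ lam).
- by move=> F mF; exact: (@caratheodory_measurable_bigcup _ _ lam).
Qed.

Lemma lebesgue_rV_semi_sigma_additive :
  semi_sigma_additive (lam : set (borel_rV R n.+1) -> \bar R).
Proof.
move=> F mF tF mUF.
by apply: (@caratheodory_measure_sigma_additive _ _ lam) => //;
  [move=> k; exact: borel_caratheodory|exact: borel_caratheodory].
Qed.

HB.instance Definition _ := isMeasure.Build _ (borel_rV R n.+1) R lam
  lebesgue_rV0 lebesgue_rV_ge0 lebesgue_rV_semi_sigma_additive.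

Lemma lebesgue_rV_translate_le (v : V) A :
  (lam [set x | A (x - v)%R] <= lam A)%E.
Proof.
apply: le_ereal_inf_tmp => _ [F [F1 F2] <-].
apply: ereal_inf_lbound; exists (fun k => ((F k).1 + v, (F k).2 + v)).
  split => [k i /=|x Ax]; first by rewrite !mxE lerD2r.
  have [k _ Bk] := F2 _ Ax; exists k => // i /=.
  by have := Bk i; rewrite !mxE ltrBrDr lerBlDr.
by apply: eq_eseriesr => k _; congr EFin; apply: eq_bigr => i _; rewrite !mxE; ring.
Qed.

Lemma lebesgue_rV_translate (v : V) A : lam [set x | A (x - v)%R] = lam A.
Proof.
apply/eqP; rewrite eq_le lebesgue_rV_translate_le andTb.
apply: le_trans (lebesgue_rV_translate_le (- v) _).
by apply: le_lebesgue_rV => x /=; rewrite opprK addrK.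
Qed.

Lemma lebesgue_rV_scale_le (c : R) A : 0 < c ->
  (lam [set x | A (c^-1 *: x)%R] <= (c ^+ n.+1)%:E * lam A)%E.
Proof.
move=> c0; have cn : 0 < c ^+ n.+1 by rewrite exprn_gt0.
rewrite muleC -lee_pdivrMr//.
apply: le_ereal_inf_tmp => _ [F [F1 F2] <-].
rewrite lee_pdivrMr//.
pose G k := (c *: (F k).1, c *: (F k).2).
apply: (@le_trans _ _ (\sum_(k <oo) (box_volume (G k))%:E)%E).
  apply: ereal_inf_lbound; exists G => //.
  split => [k i /=|x Ax]; first by rewrite !mxE ler_pM2l.
  have [k _ Bk] := F2 _ Ax; exists k => // i /=.
  have := Bk i; rewrite !mxE => /andP[l r].
  by rewrite -ltr_pdivlMl// l -ler_pdivrMl//.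
rewrite muleC -nneseriesZl//; last first.
  by move=> k _; rewrite lee_fin box_volume_ge0.
rewrite le_eqVlt; apply/orP; left; apply/eqP.
apply: eq_eseriesr => k _; rewrite -EFinM; congr EFin.
rewrite -[X in c ^+ X](card_ord n.+1) -prodr_const -big_split /=.
by apply: eq_bigr => i _; rewrite !mxE mulrBr.
Qed.

Lemma lebesgue_rV_scale (c : R) A : 0 < c ->
  lam [set x | A (c^-1 *: x)%R] = ((c ^+ n.+1)%:E * lam A)%E.
Proof.
move=> c0; have cn : 0 < c ^+ n.+1 by rewrite exprn_gt0.
apply/eqP; rewrite eq_le lebesgue_rV_scale_le//=.
have ci : 0 < c^-1 by rewrite invr_gt0.
have := lebesgue_rV_scale_le [set x | A (c^-1 *: x)] ci.
move=> H; apply: (@le_trans _ _ ((c ^+ n.+1)%:E *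
    ((c^-1 ^+ n.+1)%:E * lam [set x | A (c^-1 *: x)%R]))%E); last first.
  by rewrite muleA -EFinM exprVn divff ?mul1e// gt_eqF.
apply: lee_wpmul2l; first by rewrite lee_fin ltW.
apply: le_trans H; apply: le_lebesgue_rV => x /=.
by rewrite invrK scalerA mulVf ?scale1r// gt_eqF.
Qed.

Lemma lebesgue_rV_box_le (ab : V * V) :
  (forall i, ab.1 0 i <= ab.2 0 i) -> (lam (box ab) <= (box_volume ab)%:E)%E.
Proof.
move=> H; apply: ereal_inf_lbound.
exists (fun k => if k == 0%N then ab else (0, 0)).
  by split => [[|k] i //=|x xab]; exists 0%N.
rewrite nneseries_recl//; last first.
  by case=> [|k] _; rewrite lee_fin box_volume_ge0// => i; rewrite /= lexx.
rewrite eseries0 ?adde0// => -[|k]// _ _.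
by rewrite /box_volume big_ord_recl /= subrr mul0r.
Qed.

End LebesgueOuter.

(** Slicing: the sections of the boxes by a hyperplane [x m = t] cover the
    lower-dimensional cube, so the claim for [m] holds for every [t]; integrate
    it over [t]. The weight [P] selects the boxes that meet the slice. *)
Lemma unit_cube_cover_volume {R : realType} (m : nat) (a b : nat -> nat -> R)
    (P : nat -> bool) :
  (forall k i, a k i <= b k i) ->
  (forall x : nat -> R, (forall i, 0 < x i <= 1) ->
     exists k, P k /\ forall i, (i < m)%N -> a k i < x i <= b k i) ->
  (1 <= \sum_(0 <= k <oo) ((P k)%:R * \prod_(i < m) (b k i - a k i))%:E)%E.
Proof.
move=> ab; elim: m P => [|m IH] P H.
  have [k [Pk _]] : exists k, P k /\ forall i, (i < 0)%N -> a k i < 1 <= b k i.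
    by apply: (H (fun=> 1)) => i; rewrite ltr01 lexx.
  apply: (@le_trans _ _ (\sum_(0 <= j < k.+1)
      ((P j)%:R * \prod_(i < 0) (b j i - a j i))%:E)%E); last first.
    apply: nneseries_lim_ge => j _ _.
    by rewrite lee_fin big_ord0 mulr1 ler0n.
  rewrite big_nat_recr //= Pk big_ord0 mulr1 leeDr//.
  by apply: sume_ge0 => j _; rewrite lee_fin big_ord0 mulr1 ler0n.
pose c k := (P k)%:R * \prod_(i < m) (b k i - a k i).
have c0 k : 0 <= c k.
  by rewrite mulr_ge0//; apply: prodr_ge0 => i _; rewrite subr_ge0.
pose I k : set R := `]a k m, b k m]%classic.
pose f k (t : R) : \bar R := ((c k)%:E * (\1_(I k) t)%:E)%E.
have f0 k t : (0 <= f k t)%E by rewrite mule_ge0// lee_fin.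
have mI k : measurable (I k : set (measurableTypeR R)).
  exact: measurable_itv.
have mfI k D : measurable_fun (D : set (measurableTypeR R)) (f k).
  apply: measurable_funTS; apply: measurable_funeM; apply/measurable_EFinP.
  exact: measurable_indic.
have slice t : (0 < t <= 1)%R -> (1 <= \sum_(0 <= k <oo) f k t)%E.
  move=> t01.
  apply: le_trans (IH (fun k => P k && (a k m < t <= b k m)) _) _.
    move=> x x01.
    have [k [Pk Hk]] := H (fun i => if i == m then t else x i)
      (fun i => if i == m as e return (0 < (if e then t else x i) <= 1)
                then t01 else x01 i).
    exists k; split.
      by rewrite Pk /=; have := Hk m (ltnSn m); rewrite eqxx.
    move=> i im; have := Hk i (ltnW im).
    by rewrite (ltn_eqF im).
  apply: lee_nneseries => [k _ _|k _].
    by rewrite lee_fin mulr_ge0//; apply: prodr_ge0 => i _; rewrite subr_ge0.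
  rewrite /f /c -EFinM lee_fin indicE.
  have -> : (t \in I k) = (a k m < t <= b k m).
    by apply/idP/idP => [|h]; rewrite ?inE /I /= in_itv.
  by rewrite mulrAC -natrM mulnb.
have -> : (1%:E = \int[@lebesgue_measure R]_(t in `]0%R, 1%R]) (cst 1%:E t))%E.
  rewrite integral_cst// mul1e.
  have := @lebesgue_measure_itv R `]0, 1]; rewrite /= lte_fin ltr01 sube0.
  by move=> <-.
apply: (@le_trans _ _ (\int[@lebesgue_measure R]_(t in `]0%R, 1%R])
    (\sum_(0 <= k <oo) f k t))%E).
  apply: ge0_le_integral => //.
  apply: (@ge0_emeasurable_sum _ _ _ _ _ xpredT) => [k t _ _|k _].
    exact: f0.
  exact: mfI.
rewrite integral_nneseries//.
apply: lee_nneseries => [k _ _|k _]; first exact: integral_ge0.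
rewrite ge0_integralZl_EFin//; last first.
  by apply: measurable_funTS; apply/measurable_EFinP; exact: measurable_indic.
rewrite integral_indic// big_ord_recr /= mulrA [leRHS]EFinM.
apply: lee_wpmul2l; first by rewrite lee_fin.
apply: (@le_trans _ _ (lebesgue_measure (I k))).
  by apply: le_measure; rewrite ?inE//; exact: measurableI.
rewrite /I lebesgue_measure_itv /= lte_fin.
by case: ifPn => // _; rewrite lee_fin subr_ge0.
Qed.

Lemma lebesgue_rV_unit_cube_ge1 {R : realType} {n : nat} :
  (1 <= lebesgue_rV (box (0%R : 'rV[R]_n.+1, const_mx 1%R)))%E.
Proof.
apply: le_ereal_inf_tmp => _ [F [F1 F2] <-].
pose a k (i : nat) := (F k).1 0 (inord i : 'I_n.+1).
pose b k (i : nat) := (F k).2 0 (inord i : 'I_n.+1).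
apply: le_trans (@unit_cube_cover_volume R n.+1 a b xpredT _ _) _.
- by move=> k i; exact: F1.
- move=> x x01; have [|k _ Bk] := F2 (\row_(i < n.+1) x i).
    by move=> i; rewrite /= !mxE.
  by exists k; split => // i im; have := Bk (inord i); rewrite mxE inordK.
apply: lee_nneseries => [k _ _|k _].
  by rewrite lee_fin mul1r; apply: prodr_ge0 => i _; rewrite subr_ge0 F1.
by rewrite lee_fin mul1r le_eqVlt; apply/orP; left; apply/eqP;
  apply: eq_bigr => i _; rewrite /a /b inord_val.
Qed.

(** * Volumes of cylinders *)

Section Cylinders.
Context {R : realType} {n : nat}.
Local Notation V := 'rV[R]_n.+1.
Local Notation lam := (@lebesgue_rV R n.+1).
Local Notation bV := (borel_rV R n.+1).
Implicit Types (e x : V) (a b : R) (A : set V).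

Lemma open_measurable_rV A : open A -> measurable (A : set bV).
Proof. exact: sub_gen_smallest. Qed.

Lemma closed_measurable_rV A : closed A -> measurable (A : set bV).
Proof.
move=> cA; rewrite -[A]setCK; apply: measurableC; apply: open_measurable_rV.
exact: closed_openC.
Qed.

Lemma measurable_lt_continuous (f : V -> R) a :
  continuous f -> measurable ([set x | f x < a] : set bV).
Proof.
move=> cf; apply: open_measurable_rV.
by apply: (@open_comp _ _ f [set t | t < a]) => [x _|]; [exact: cf|exact: open_lt].
Qed.

Lemma measurable_ge_continuous (f : V -> R) a :
  continuous f -> measurable ([set x | a <= f x] : set bV).
Proof.
move=> cf; rewrite (_ : [set x | _] = ~` [set x | f x < a]).
  by apply: measurableC; exact: measurable_lt_continuous.
by apply/seteqP; split => x /=; rewrite leNgt => /negP.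
Qed.

Lemma measurable_le_continuous (f : V -> R) a :
  continuous f -> measurable ([set x | f x <= a] : set bV).
Proof.
move=> cf; rewrite (_ : [set x | _] = [set x | - a <= - f x]).
  by apply: measurable_ge_continuous => x; apply: continuousN; exact: cf.
by apply/seteqP; split => x /=; rewrite lerN2.
Qed.

Lemma bounded_lebesgue_rV A r : (forall x i, A x -> `|x 0 i| <= r) ->
  (lam A < +oo)%E.
Proof.
move=> H; pose s := Num.max r 0 + 1.
have rs : r < s by rewrite ltr_pwDr// le_max lexx.
have s0 : 0 <= s by rewrite addr_ge0// le_max lexx orbT.
apply: (@le_lt_trans _ _ (lam (box (const_mx (- s), const_mx s)))).
  apply: le_lebesgue_rV => x Ax i; rewrite !mxE /=.
  have := H _ i Ax; rewrite ler_norml => /andP[h1 h2].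
  by apply/andP; split; lra.
apply: le_lt_trans (lebesgue_rV_box_le _) (ltry _) => i /=.
by rewrite !mxE; lra.
Qed.

(** Half-open along the axis, so that cylinders of equal radius tile a longer
    one. *)
Definition cyl e a b : set V :=
  [set x | 0 <= dotv x e < a /\ enorm (perp e x) <= b].

Section unit_axis.
Variable e : V.
Hypothesis e1 : enorm e = 1.

Lemma enorm_perp_continuous : continuous (fun x => enorm (perp e x)).
Proof.
apply: (@enorm_lip_continuous _ _ _ 1) => x y.
by rewrite mul1r (le_trans (enorm_lip _ _))// -perpB enorm_perp_le.
Qed.

Lemma measurable_cyl a b : measurable (cyl e a b : set bV).
Proof.
rewrite (_ : cyl e a b = [set x | 0 <= dotv x e] `&` [set x | dotv x e < a]
    `&` [set x | enorm (perp e x) <= b]); last first.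
  apply/seteqP; split => x /=; first by move=> [/andP[h1 h2] h3].
  by move=> [[h1 h2] h3]; split => //; rewrite h1 h2.
apply: measurableI; last first.
    by apply: measurable_le_continuous; exact: enorm_perp_continuous.
apply: measurableI.
  by apply: measurable_ge_continuous; exact: dotv_continuous.
by apply: measurable_lt_continuous; exact: dotv_continuous.
Qed.

Lemma cyl_coord a b x i : cyl e a b x -> `|x 0 i| <= a + b.
Proof.
move=> [/andP[h1 h2] h3]; apply: le_trans (coord_le_enorm _ _) _.
by rewrite (le_trans (enorm_le_perp e1 x))// ger0_norm// lerD// ltW.
Qed.

Lemma lebesgue_cyl_fin a b : lam (cyl e a b) \is a fin_num.
Proof.
rewrite ge0_fin_numE ?lebesgue_rV_ge0//.
by apply: (@bounded_lebesgue_rV _ (a + b)) => x i; exact: cyl_coord.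
Qed.

Lemma lebesgue_cyl_scale t a b : 0 < t ->
  lam (cyl e (t * a) (t * b)) = ((t ^+ n.+1)%:E * lam (cyl e a b))%E.
Proof.
move=> t0; rewrite -lebesgue_rV_scale//; congr (lam _).
apply/seteqP; split => x; rewrite /cyl /= dotvZl perpZ enormZ;
    rewrite gtr0_norm ?invr_gt0// !ler_pdivrMl// ltr_pdivrMl//;
    by rewrite pmulr_rge0 ?invr_gt0.
Qed.

Lemma lebesgue_cyl_natmul k a b : 0 <= a ->
  lam (cyl e (k%:R * a) b) = (k%:R%:E * lam (cyl e a b))%E.
Proof.
move=> a0; elim: k => [|k IH].
  rewrite !mul0r mul0e (_ : cyl _ _ _ = set0) ?lebesgue_rV0//.
  apply/seteqP; split => x //= -[/andP[h1 h2] _].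
  by have := le_lt_trans h1 h2; rewrite ltxx.
have ka0 : 0 <= k%:R * a by rewrite mulr_ge0.
pose B : set V := [set x | cyl e a b (x - (k%:R * a) *: e)%R].
have BE x : B x <-> k%:R * a <= dotv x e < k.+1%:R * a /\ enorm (perp e x) <= b.
  rewrite /B /cyl /= dotvBl dotvZl dotv_unit// mulr1 perpB perpZ perp_unit//.
  by rewrite scaler0 subr0 subr_ge0 ltrBlDr -natr1 mulrDl mul1r (addrC a).
have mB : measurable (B : set bV).
  rewrite (_ : B = [set x | k%:R * a <= dotv x e] `&`
     [set x | dotv x e < k.+1%:R * a] `&` [set x | enorm (perp e x) <= b]).
    apply: measurableI; last first.
    by apply: measurable_le_continuous; exact: enorm_perp_continuous.
    apply: measurableI.
      by apply: measurable_ge_continuous; exact: dotv_continuous.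
    by apply: measurable_lt_continuous; exact: dotv_continuous.
  apply/seteqP; split => x; first by move=> /BE[/andP[? ?] ?].
  by move=> [[h1 h2] h3]; apply/BE; split => //; apply/andP.
have -> : cyl e (k.+1%:R * a) b = cyl e (k%:R * a) b `|` B.
  apply/seteqP; split => x.
    move=> [/andP[h1 h2] h3].
    have [h|h] := ltP (dotv x e) (k%:R * a); first by left; rewrite /cyl /= h1 h.
    by right; apply/BE; rewrite h h2.
  case=> [[/andP[h1 h2] h3]|/BE[/andP[h1 h2] h3]]; split => //; apply/andP; split => //.
    by apply: lt_le_trans h2 _; rewrite ler_wpM2r// ler_nat.
  exact: le_trans h1.
have -> : lam (cyl e (k%:R * a) b `|` B) = (lam (cyl e (k%:R * a) b) + lam B)%E.
  apply: measureU => //; first exact: measurable_cyl.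
  apply/seteqP; split => x //= -[[/andP[_ h1] _] /BE[/andP[h2 _] _]].
  by have := lt_le_trans h1 h2; rewrite ltxx.
rewrite IH [X in (_ + X)%E]lebesgue_rV_translate -natr1 EFinD muleDl ?mul1e//.
exact: lebesgue_cyl_fin.
Qed.

Lemma le_lebesgue_cyl a a' b : a <= a' -> (lam (cyl e a b) <= lam (cyl e a' b))%E.
Proof.
move=> aa; apply: le_lebesgue_rV => x [/andP[h1 h2] h3]; split => //.
by rewrite h1 (lt_le_trans h2).
Qed.

(** Additivity and monotonicity in the length make the volume proportional to
    it; comparing with whole multiples already gives this up to a factor 2. *)
Lemma lebesgue_cyl_ratio a a' b : 0 < a -> 0 < a' ->
  (lam (cyl e a b) <= (2 * (a / a'))%:E * lam (cyl e a' b))%E.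
Proof.
move=> a0 a'0.
pose p := (Num.truncn (a' / a)).+1.
pose q := (Num.truncn (p%:R * a / a')).+1.
have p0 : 0 < p%:R :> R by rewrite ltr0n.
have hp : a' <= p%:R * a.
  by rewrite -ler_pdivrMr// ltW// truncnS_gt.
have hq : p%:R * a <= q%:R * a'.
  by rewrite -[leLHS]mulr1 -ler_pdivrMr// mulr1 ltW// truncnS_gt.
have hq2 : q%:R <= 2 * (p%:R * a / a').
  have h : (Num.truncn (p%:R * a / a'))%:R <= p%:R * a / a'.
    by rewrite truncn_le// divr_ge0 ?mulr_ge0 ?ltW.
  have h1 : 1 <= p%:R * a / a' by rewrite ler_pdivlMr// mul1r.
  rewrite /q -natr1; lra.
have := @le_lebesgue_cyl _ _ b hq.
rewrite (lebesgue_cyl_natmul p b (ltW a0)) (lebesgue_cyl_natmul q b (ltW a'0)).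
rewrite -(fineK (lebesgue_cyl_fin a b)) -(fineK (lebesgue_cyl_fin a' b)).
have g0 : 0 <= fine (lam (cyl e a' b)) by rewrite fine_ge0 ?lebesgue_rV_ge0.
move: (fine (lam (cyl e a b))) (fine (lam (cyl e a' b))) g0 => ga ga' ga'0.
rewrite -!EFinM !lee_fin => H; rewrite -(ler_pM2l p0); apply: le_trans H _.
apply: le_trans (ler_wpM2r ga'0 hq2) _.
by rewrite le_eqVlt; apply/orP; left; apply/eqP; ring.
Qed.

End unit_axis.

(** The unit cylinder contains a cube centred at [2^-1 *: e] and lies in a cube
    centred at the origin, both of a size that depends on the dimension only. *)
Lemma cyl_unit_bounds : exists c C : R, [/\ 0 < c, 0 < C &
  forall e, enorm e = 1 -> (c%:E <= lam (cyl e 1 1) <= C%:E)%E].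
Proof.
pose r : R := (4 * n.+1%:R)^-1.
have r0 : 0 < r by rewrite invr_gt0 mulr_gt0.
exists (r ^+ n.+1), (6 ^+ n.+1); split; [by rewrite exprn_gt0..|] => e e1.
apply/andP; split.
  pose Q : set V := [set x | box (0 : V, const_mx 1) (r^-1 *: x)%R].
  apply: (@le_trans _ _ (lam [set x | Q (x - 2^-1 *: e)%R])).
    rewrite lebesgue_rV_translate lebesgue_rV_scale//.
    rewrite -[leLHS]mule1 lee_wpmul2l//; first by rewrite lee_fin exprn_ge0// ltW.
    exact: lebesgue_rV_unit_cube_ge1.
  apply: le_lebesgue_rV => x Qx.
  set y := x - 2^-1 *: e in Qx.
  have yn : enorm y <= 4^-1.
    apply: le_trans (enorm_le_norm _) _.
    rewrite -ler_pdivlMl// (_ : _ * _ = r) ?/r ?invfM 1?mulrC//.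
    apply: norm_le_coord => [|i]; first by rewrite mulr_ge0.
    have := Qx i; rewrite /= !mxE => /andP[h1 h2].
    rewrite ler_pdivrMl// mulr1 in h2.
    rewrite pmulr_rgt0 ?invr_gt0// in h1.
    by rewrite gtr0_norm// (_ : _ / 4 = r)// /r invfM mulrC.
  have -> : x = y + 2^-1 *: e by rewrite subrK.
  rewrite /cyl /= dotvDl dotvZl dotv_unit// mulr1 perpD perpZ perp_unit// scaler0.
  rewrite addr0.
  have := norm_dotv_unit_le e1 y; have := enorm_perp_le e1 y.
  move=> h1; rewrite ler_norml => /andP[h2 h3].
  by split; [apply/andP; split; lra|lra].
apply: (@le_trans _ _ (lam (box (const_mx (- 3) : V, const_mx 3)))).
  apply: le_lebesgue_rV => x /cyl_coord H i; rewrite /= !mxE.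
  have := H e1 i; rewrite ler_norml => /andP[h1 h2].
  by apply/andP; split; lra.
apply: le_trans (lebesgue_rV_box_le _) _ => [i|]; rewrite /= ?mxE; first lra.
rewrite lee_fin /box_volume /= (eq_bigr (fun=> 6)); last first.
  by move=> i _; rewrite !mxE; lra.
by rewrite prodr_const card_ord.
Qed.

(** Scaling by [b] and the ratio of lengths reduce every cylinder to the unit
    one; the constants are uniform in the direction [e] of the axis. *)
Lemma cyl_volume : exists c C : R, [/\ 0 < c, 0 < C &
  forall e a b, enorm e = 1 -> 0 < a -> 0 < b ->
    ((c * a * b ^+ n)%:E <= lam (cyl e a b) <= (C * a * b ^+ n)%:E)%E].
Proof.
have [c [C [c0 C0 H]]] := cyl_unit_bounds.
exists (c / 2), (2 * C); split; [by rewrite divr_gt0|by rewrite mulr_gt0|].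
move=> e a b e1 a0 b0; have /andP[] := H e e1.
have h0 := lebesgue_cyl_scale e 1 1 b0; rewrite !mulr1 in h0.
have h1 := lebesgue_cyl_ratio e1 b a0 b0.
have h2 := lebesgue_cyl_ratio e1 b b0 a0.
rewrite h0 in h1 h2; move: h1 h2.
rewrite -(fineK (lebesgue_cyl_fin e1 a b)) -(fineK (lebesgue_cyl_fin e1 1 1)).
move: (fine (lam (cyl e a b))) (fine (lam (cyl e 1 1))) => ga g1.
rewrite -!EFinM !lee_fin => h1 h2 h3 h4.
rewrite exprS in h1 h2.
have bn : 0 < b ^+ n by rewrite exprn_gt0.
apply/andP; split.
  have : b * b ^+ n * c <= 2 * (b / a) * ga.
    by apply: le_trans h2; rewrite ler_wpM2l// mulr_ge0 ?ltW.
  move=> h5; have ab0 : 0 < a / (2 * b) by rewrite divr_gt0 ?mulr_gt0.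
  have := ler_wpM2r (ltW ab0) h5.
  have -> : 2 * (b / a) * ga * (a / (2 * b)) = ga.
    by field; rewrite !gt_eqF.
  apply: le_trans; rewrite le_eqVlt; apply/orP; left; apply/eqP.
  by field; rewrite gt_eqF.
apply: le_trans h1 _.
have -> : 2 * (a / b) * (b * b ^+ n * g1) = 2 * a * b ^+ n * g1.
  by field; rewrite gt_eqF.
rewrite (_ : 2 * C * a * _ = 2 * a * b ^+ n * C); last by ring.
by rewrite ler_wpM2l// !mulr_ge0// ltW.
Qed.

End Cylinders.

(** * Convex domains and the distance to the boundary *)

Section EuclidTopology.
Context {R : realType} {n : nat}.
Local Notation V := 'rV[R]_n.+1.
Implicit Types (x y z : V) (A : set V).

Lemma nbhs_enormP x A :
  nbhs x A <-> exists2 r, 0 < r & forall y, enorm (y - x) < r -> A y.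
Proof.
split.
  move=> /nbhs_ballP[e /= e0 H]; exists e => // y yx; apply: H.
  rewrite -ball_normE /=; apply: le_lt_trans (norm_le_enorm _) _.
  by rewrite enormB.
move=> [r r0 H]; apply/nbhs_ballP; exists (r / n.+1%:R); rewrite /= ?divr_gt0//.
move=> y; rewrite -ball_normE /= => yx; apply: H; rewrite enormB.
by apply: le_lt_trans (enorm_le_norm _) _; rewrite mulrC -ltr_pdivlMr.
Qed.

Lemma open_enormP A :
  open A <-> forall x, A x -> exists2 r, 0 < r & forall y, enorm (y - x) < r -> A y.
Proof.
split=> [oA x Ax|H]; first exact/nbhs_enormP/open_nbhs_nbhs.
by rewrite openE => x /H /nbhs_enormP.
Qed.

Lemma closure_enormP A x :
  closure A x <-> forall r, 0 < r -> exists2 y, A y & enorm (y - x) < r.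
Proof.
split=> [cA r r0|H B /nbhs_enormP[r r0 rB]].
  have /cA[y [Ay ry]] : nbhs x [set y | enorm (y - x) < r].
    by apply/nbhs_enormP; exists r.
  by exists y.
by have [y Ay /rB By] := H _ r0; exists y.
Qed.

Lemma within_continuous_enormP A (f : V -> R) x e :
  {within A, continuous f} -> A x -> 0 < e ->
  exists2 r, 0 < r & forall y, A y -> enorm (y - x) < r -> `|f y - f x| < e.
Proof.
move=> /subspace_continuousP cf Ax e0.
have /cvgrPdist_lt/(_ _ e0) := cf x Ax.
rewrite /within /= => /nbhs_enormP[r r0 H]; exists r => // y Ay yx.
by rewrite distrC; exact: H.
Qed.

Lemma compact_enorm A r : closed A -> (forall x, A x -> enorm x <= r) -> compact A.
Proof.
move=> cA H; apply: bounded_closed_compact => //.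
exists r; split; first exact: num_real.
move=> s rs x Ax; apply: le_trans (norm_le_enorm _) _.
exact: le_trans (H _ Ax) (ltW rs).
Qed.

End EuclidTopology.

Section Domain.
Context {R : realType} {n : nat}.
Local Notation V := 'rV[R]_n.+1.
Local Notation lam := (@lebesgue_rV R n.+1).
Variable Omega : set V.
Hypothesis oOmega : open Omega.
Hypothesis cOmega : forall x y t, Omega x -> Omega y -> 0 <= t <= 1 ->
  Omega (t *: x + (1 - t) *: y).
Variable D : R.
Hypothesis bOmega : forall x, Omega x -> enorm x <= D.
Implicit Types (x y z v : V) (t s : R).
Local Notation bd := (boundary Omega).
Local Notation dist x := (euclid_dist x bd).

Lemma boundaryE z : bd z <-> closure Omega z /\ ~ Omega z.
Proof. by rewrite /boundary ((interior_id _).1 oOmega). Qed.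

Lemma closure_bounded z : closure Omega z -> enorm z <= D.
Proof.
move=> /closure_enormP H; apply/ler_addgt0Pr => e e0.
have [y Oy yz] := H e e0.
rewrite -[z](subrK y) addrC; apply: le_trans (enormD _ _) _.
by rewrite lerD ?bOmega// enormB ltW.
Qed.

Lemma closed_bd : closed bd.
Proof.
rewrite /boundary setDE; apply: closedI; first exact: closed_closure.
exact/open_closedC/open_interior.
Qed.

Lemma compact_closure_Omega : compact (closure Omega).
Proof.
apply: (compact_enorm (r := D)); [exact: closed_closure|exact: closure_bounded].
Qed.

(** The last parameter up to which points of [Omega] are found on the segment. *)
Lemma segment_boundary x y : Omega x -> ~ Omega y ->
  exists s, [/\ 0 < s, s <= 1 & bd (x + s *: (y - x))].
Proof.
move=> Ox NOy.
pose S := [set s | 0 <= s <= 1 /\ Omega (x + s *: (y - x))].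
have S0 : S 0 by split; rewrite ?lexx ?ler01// scale0r addr0.
have uS : ubound S 1 by move=> s [/andP[]].
have hS : has_sup S by split; [exists 0|exists 1].
pose s0 := sup S.
have s01 : s0 <= 1 by apply: ge_sup => //; exists 0.
have s00 : 0 <= s0 by apply: ub_le_sup => //; exists 1.
have key a b : enorm ((x + a *: (y - x)) - (x + b *: (y - x))) =
    `|a - b| * enorm (y - x).
  by rewrite opprD addrACA subrr add0r -scalerBl enormZ.
have yx0 : 0 < enorm (y - x).
  apply: enorm_gt0; apply: contra_notN NOy; rewrite subr_eq0 => /eqP -> //.
have NOs : ~ Omega (x + s0 *: (y - x)).
  move=> Os.
  have [s1|s1] := eqVneq s0 1.
    by apply: NOy; move: Os; rewrite s1 scale1r addrC subrK.
  have [r r0 H] := (open_enormP _).1 oOmega _ Os.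
  pose e := Num.min (1 - s0) (r / (2 * enorm (y - x))).
  have e0 : 0 < e.
    rewrite lt_min divr_gt0 ?mulr_gt0// andbT subr_gt0 lt_neqAle s1 s01//.
  have : S (s0 + e).
    split.
      by rewrite addr_ge0 ?(ltW e0)//= -lerBrDl ge_min lexx.
    apply: H; rewrite key addrAC subrr add0r gtr0_norm//.
    apply: (@le_lt_trans _ _ (r / (2 * enorm (y - x)) * enorm (y - x))).
      by rewrite ler_wpM2r ?enorm_ge0// ge_min lexx orbT.
    rewrite invfM mulrA -mulrA mulVf ?gt_eqF// mulr1; lra.
  move=> /(ub_le_sup hS.2); rewrite -/s0; lra.
exists s0; split => //.
  rewrite lt_neqAle s00 andbT; apply: contra_notN NOs => /eqP <-.
  by rewrite scale0r addr0.
apply/boundaryE; split => //; apply/closure_enormP => r r0.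
have e0 : 0 < r / (2 * enorm (y - x)) by rewrite divr_gt0 ?mulr_gt0.
have [s [sS Os] ss] := sup_adherent e0 hS.
exists (x + s *: (y - x)) => //; rewrite key.
have hs : s <= s0 by apply: ub_le_sup => //; exists 1.
rewrite ler0_norm ?subr_le0//.
apply: (@le_lt_trans _ _ (r / (2 * enorm (y - x)) * enorm (y - x))).
  rewrite ler_wpM2r ?enorm_ge0//; rewrite -/s0 in ss; lra.
rewrite invfM mulrA -mulrA mulVf ?gt_eqF// mulr1; lra.
Qed.

Lemma ray_boundary x v : Omega x -> v != 0 ->
  exists2 s, 0 < s & bd (x + s *: v).
Proof.
move=> Ox v0; have v1 := enorm_gt0 v0.
pose T := (2 * (D + 1)) / enorm v.
have D0 : 0 <= D := le_trans (enorm_ge0 _) (bOmega Ox).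
have T0 : 0 < T by rewrite divr_gt0// mulr_gt0// ltr_wpDl.
have NO : ~ Omega (x + T *: v).
  move=> /bOmega h.
  have : enorm (T *: v) <= 2 * D.
    rewrite -[T *: v](addrK x) addrC; apply: le_trans (enormD _ _) _.
    by rewrite enormN (addrC _ x); have := bOmega Ox; lra.
  by rewrite enormZ gtr0_norm// /T mulfVK ?gt_eqF//; lra.
have [s [s0 s1 H]] := segment_boundary Ox NO.
exists (s * T); first by rewrite mulr_gt0.
by move: H; have -> : x + T *: v - x = T *: v; rewrite ?scalerA// addrAC subrr add0r.
Qed.

Section dist.
Variable x0 : V.
Hypothesis Ox0 : Omega x0.

Lemma bd_nonempty : exists z, bd z.
Proof.
have [|s _ H] := @ray_boundary x0 (const_mx 1) Ox0; last by exists (x0 + s *: const_mx 1).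
by apply/eqP => /rowP/(_ ord0); rewrite !mxE => /eqP; rewrite oner_eq0.
Qed.

Lemma dist_has_lbound x : has_lbound [set enorm (x - y) | y in bd].
Proof. by exists 0 => _ [y _ <-]; exact: enorm_ge0. Qed.

Lemma dist_le x z : bd z -> dist x <= enorm (x - z).
Proof. by move=> bz; apply: ge_inf; [exact: dist_has_lbound|exists z]. Qed.

Lemma le_dist x t : (forall z, bd z -> t <= enorm (x - z)) -> t <= dist x.
Proof.
move=> H; apply: lb_le_inf; last by move=> _ [z bz <-]; exact: H.
by have [z bz] := bd_nonempty; exists (enorm (x - z)); exists z.
Qed.

Lemma dist_ge0 x : 0 <= dist x.
Proof. by apply: le_dist => z _; exact: enorm_ge0. Qed.

Lemma dist_boundary z : bd z -> dist z = 0.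
Proof.
move=> bz; apply/eqP; rewrite eq_le dist_ge0 andbT.
by rewrite (le_trans (dist_le _ bz))// subrr enorm0.
Qed.

Lemma dist_lip x y : `|dist x - dist y| <= enorm (x - y).
Proof.
have H a b : dist a - enorm (a - b) <= dist b.
  apply: le_dist => z bz; rewrite lerBlDr addrC.
  apply: le_trans (dist_le _ bz) _.
  by rewrite -(subrK b a) -addrA (le_trans (enormD _ _))// addrK.
have h1 := H x y; have h2 := H y x; rewrite (enormB y) in h2.
by rewrite ler_norml; apply/andP; split; lra.
Qed.

Lemma dist_continuous : continuous (fun x => dist x).
Proof.
by apply: (@enorm_lip_continuous _ _ _ 1) => x y; rewrite mul1r dist_lip.
Qed.

Lemma le_dist_ball x r : Omega x ->
  (forall y, enorm (y - x) < r -> Omega y) -> r <= dist x.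
Proof.
move=> Ox H; apply: le_dist => z /boundaryE[_ NOz].
by rewrite leNgt; apply/negP; rewrite enormB => /H.
Qed.

Lemma dist_gt0 x : Omega x -> 0 < dist x.
Proof.
move=> Ox; have [r r0 H] := (open_enormP _).1 oOmega _ Ox.
exact: lt_le_trans (le_dist_ball Ox H).
Qed.

Lemma dist_ball x y : Omega x -> enorm (y - x) < dist x -> Omega y.
Proof.
move=> Ox yx; apply: contrapT => NOy.
have [s [s0 s1 bz]] := segment_boundary Ox NOy.
have := dist_le x bz; rewrite opprD addrA subrr add0r enormN enormZ.
rewrite gtr0_norm// => h; have := lt_le_trans yx h.
by rewrite ltNge ler_piMl// enorm_ge0.
Qed.

Lemma nearest_boundary x : exists2 z, bd z & dist x = enorm (x - z).
Proof.
have cb : compact bd.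
  apply: (compact_enorm (r := D)); first exact: closed_bd.
  by move=> z /boundaryE[/closure_bounded].
have cf : {within bd, continuous (fun z => enorm (x - z))}.
  apply: continuous_subspaceT; apply: (@enorm_lip_continuous _ _ _ 1) => y z.
  rewrite mul1r (le_trans (enorm_lip _ _))//.
  by rewrite opprB addrC subrKA enormB.
have [z zb zmin] := compact_EVT_min bd_nonempty cb cf.
rewrite inE in zb; exists z => //; apply/eqP; rewrite eq_le dist_le//=.
by apply: le_dist => y yb; apply: zmin; rewrite inE.
Qed.

(** The ball of radius [dist x] about [x] and the convexity of [Omega] force the
    tangent hyperplane at a nearest boundary point to support [Omega]; the
    distance to the boundary is at most the distance to that hyperplane. *)
Lemma support_dist x : Omega x -> exists2 e, enorm e = 1 &
  forall y, Omega y -> dist y <= dist x + dotv (y - x) e.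
Proof.
move=> Ox; have d0 := dist_gt0 Ox.
have [z bz dz] := nearest_boundary x.
have [_ NOz] := (boundaryE z).1 bz.
pose d := dist x.
have [e e1 xz] : exists2 e, enorm e = 1 & x - z = d *: e.
  exists (d^-1 *: (x - z)).
    by rewrite enormZ -dz gtr0_norm ?invr_gt0// mulVf// gt_eqF.
  by rewrite scalerA divff ?scale1r// gt_eqF.
have lneg y : Omega y -> ~ dotv (y - z) e < 0.
  move=> Oy yneg.
  pose m := - dotv (y - z) e; have m0 : 0 < m by rewrite oppr_gt0.
  have yz : 0 < enorm (y - z).
    by apply: enorm_gt0; apply: contraTneq m0 => H; rewrite /m H dotv0l oppr0 ltxx.
  pose s := d * m / enorm (y - z) ^+ 2.
  have s0 : 0 < s by rewrite divr_gt0 ?mulr_gt0// exprn_gt0.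
  pose w := z + s *: (z - y).
  have Ow : Omega w.
    apply: (@dist_ball x) => //.
    rewrite -(@ltr_pXn2r _ 2)// ?nnegrE ?enorm_ge0 ?ltW//.
    have -> : w - x = - (d *: e + s *: (y - z)).
      by rewrite -xz /w; apply/rowP => i; rewrite !mxE; ring.
    rewrite enormN sqr_enormD dotvZl dotvZr !enormZ e1 mulr1 -/d !gtr0_norm//.
    rewrite (dotvC e) -(opprK (dotv (y - z) e)) -/m.
    have -> : d ^+ 2 + 2 * (d * (s * - m)) + (s * enorm (y - z)) ^+ 2 =
        d ^+ 2 - s * (d * m).
      rewrite /s; field; by rewrite gt_eqF.
    by rewrite ltrBlDr ltrDl (mulr_gt0 s0 (mulr_gt0 d0 m0)).
  apply: NOz.
  have s10 : 0 < 1 + s by rewrite addr_gt0.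
  have -> : z = (1 + s)^-1 *: w + (1 - (1 + s)^-1) *: y.
    by apply/rowP => i; rewrite !mxE; field; rewrite gt_eqF.
  by apply: cOmega => //; rewrite invr_ge0 ltW//= invf_le1// lerDl ltW.
have lpos y : Omega y -> 0 < dotv (y - z) e.
  move=> Oy; rewrite ltNge; apply/negP => yneg.
  have [r r0 H] := (open_enormP _).1 oOmega _ Oy.
  apply: (lneg (y - (r / 2) *: e)).
    apply: H; rewrite addrAC subrr add0r enormN enormZ e1 mulr1 gtr0_norm; lra.
  rewrite addrAC dotvBl dotvZl dotv_unit// mulr1; lra.
exists e => // y Oy.
pose l := dotv (y - z) e.
have -> : dist x + dotv (y - x) e = l.
  rewrite /l (_ : y - z = (x - z) + (y - x)); last first.
    by apply/rowP => i; rewrite !mxE; ring.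
  by rewrite [RHS]dotvDl xz dotvZl dotv_unit// mulr1.
have NOp : ~ Omega (y - l *: e).
  by move=> /lpos; rewrite addrAC dotvBl dotvZl dotv_unit// mulr1 -/l subrr ltxx.
have [s [s0 s1 bs]] := segment_boundary Oy NOp.
apply: le_trans (dist_le _ bs) _.
rewrite opprD addrA subrr add0r enormN enormZ addrAC subrr add0r enormN enormZ e1.
by rewrite mulr1 !gtr0_norm ?ler_piMl//; [exact/ltW/lpos|exact: lpos].
Qed.

End dist.

(** If [x'] in [Omega] is close to [x], the point can be written as a combination
    of [x'] and of a small perturbation of [y]. *)
Lemma closure_interior_point x y t : closure Omega x -> Omega y -> 0 < t <= 1 ->
  Omega (t *: y + (1 - t) *: x).
Proof.
move=> cx Oy /andP[t0 t1].
have [r r0 H] := (open_enormP _).1 oOmega _ Oy.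
have [x' Ox' xx'] := (closure_enormP _ _).1 cx (t * r) (mulr_gt0 t0 r0).
have -> : t *: y + (1 - t) *: x =
    t *: (y + ((1 - t) / t) *: (x - x')) + (1 - t) *: x'.
  by apply/rowP => i; rewrite !mxE; field; rewrite gt_eqF.
apply: cOmega => //; last by rewrite ltW.
apply: H; rewrite addrAC subrr add0r enormZ enormB.
have t1' : 0 <= 1 - t by lra.
rewrite ger0_norm; last by rewrite divr_ge0 ?(ltW t0).
rewrite mulrAC ltr_pdivrMr//.
apply: (@le_lt_trans _ _ (1 * enorm (x' - x))).
  by rewrite ler_wpM2r ?enorm_ge0//; lra.
by rewrite mul1r mulrC.
Qed.

Lemma lebesgue_Omega_fin : lam Omega \is a fin_num.
Proof.
rewrite ge0_fin_numE ?lebesgue_rV_ge0//.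
apply: (@bounded_lebesgue_rV _ _ _ D) => x i Ox.
exact: le_trans (coord_le_enorm _ _) (bOmega Ox).
Qed.

(** Shrinking [Omega] by the factor [1 - s] towards a fixed interior point moves
    every point a distance comparable to [s] away from the boundary. *)
Lemma boundary_layer_volume x0 : Omega x0 -> exists2 C, 0 <= C &
  forall t, 0 < t -> (lam [set x | Omega x /\ (dist x < t)%R] <= (C * t)%:E)%E.
Proof.
move=> Ox0; pose r := dist x0; have r0 : 0 < r := dist_gt0 Ox0 Ox0.
pose L := fine (lam Omega).
have L0 : 0 <= L by rewrite fine_ge0// lebesgue_rV_ge0.
have LE : lam Omega = L%:E by rewrite fineK// lebesgue_Omega_fin.
exists (n.+1%:R * L / r) => [|t t0]; first by rewrite divr_ge0 ?mulr_ge0// ltW.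
have [rt|tr] := leP r t.
  apply: (@le_trans _ _ (lam Omega)); first by apply: le_lebesgue_rV => x [].
  rewrite LE lee_fin (_ : _ * t = L * (n.+1%:R * (t / r))); last by ring.
  by rewrite ler_peMr// mulr_ege1 ?ler1n// ler_pdivlMr// mul1r.
pose s := t / r.
have s0 : 0 < s by rewrite divr_gt0.
have s1 : s < 1 by rewrite ltr_pdivrMr// mul1r.
have s1' : 0 < 1 - s by rewrite subr_gt0.
pose Os : set V := [set x | Omega (x0 + (1 - s)^-1 *: (x - x0))].
have split_ x : x = (1 - s) *: (x0 + (1 - s)^-1 *: (x - x0)) + (1 - (1 - s)) *: x0.
  by apply/rowP => i; rewrite !mxE; field; rewrite gt_eqF.
have Os_sub : Os `<=` Omega.
  move=> x Ox; rewrite (split_ x); apply: cOmega => //.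
  by rewrite ltW//=; lra.
have Os_dist x : Os x -> t <= dist x.
  move=> Ox; apply: (le_dist_ball Ox0); first exact: Os_sub.
  move=> y yx.
  have -> : y = (1 - s) *: (x0 + (1 - s)^-1 *: (x - x0)) +
      (1 - (1 - s)) *: (x0 + s^-1 *: (y - x)).
    by apply/rowP => i; rewrite !mxE; field; rewrite !gt_eqF.
  apply: cOmega => //; last by rewrite ltW//=; lra.
  apply: (dist_ball Ox0).
  rewrite addrAC subrr add0r enormZ gtr0_norm ?invr_gt0//.
  by rewrite ltr_pdivrMl// /s mulfVK// gt_eqF.
have oOs : open Os.
  apply/open_enormP => x Ox; have [e e0 H] := (open_enormP _).1 oOmega _ Ox.
  exists ((1 - s) * e); first by rewrite mulr_gt0.
  move=> y yx; apply: H.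
  rewrite opprD addrACA subrr add0r -scalerBr enormZ gtr0_norm ?invr_gt0//.
  by rewrite opprB addrA subrK ltr_pdivrMl.
have lOs : lam Os = ((1 - s) ^+ n.+1 * L)%:E.
  have -> : Os = [set x | [set w : V | [set y : V | Omega (y - (- x0))]
      ((1 - s)^-1 *: w)] (x - x0)].
    by apply/seteqP; split => x; rewrite /Os /= opprK addrC.
  by rewrite lebesgue_rV_translate lebesgue_rV_scale// lebesgue_rV_translate LE.
apply: (@le_trans _ _ (lam (Omega `\` Os))).
  apply: le_lebesgue_rV => x [Ox dx]; split => // /Os_dist.
  by rewrite leNgt dx.
have mO : measurable (Omega : set (borel_rV R n.+1)) by exact: open_measurable_rV.
have mOs : measurable (Os : set (borel_rV R n.+1)) by exact: open_measurable_rV.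
have := borel_caratheodory mOs Omega.
rewrite (setIidr Os_sub) -setDE lOs LE.
have fD : lam (Omega `\` Os) \is a fin_num.
  rewrite ge0_fin_numE ?lebesgue_rV_ge0//.
  apply: le_lt_trans (ltry L); rewrite -LE; apply: le_lebesgue_rV; exact: subDsetl.
rewrite -(fineK fD); move: (fine _) => g; rewrite -EFinD => -[Lg].
(* Bernoulli's inequality bounds the volume lost in the shrinking. *)
have bern k : 1 - k%:R * s <= (1 - s) ^+ k.
  elim: k => [|k IH]; first by rewrite mul0r subr0 expr0.
  rewrite exprS; apply: le_trans (ler_wpM2l (ltW s1') IH).
  have : 0 <= k%:R * s * s by rewrite -mulrA mulr_ge0// -expr2 sqr_ge0.
  by rewrite -natr1; lra.
rewrite lee_fin.
have -> : n.+1%:R * L / r * t = n.+1%:R * s * L by rewrite /s; field; rewrite gt_eqF.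
have := ler_wpM2r L0 (bern n.+1); lra.
Qed.

End Domain.

(** * Convex functions vanishing on the boundary *)

Section ConvexFunction.
Context {R : realType} {n : nat}.
Local Notation V := 'rV[R]_n.+1.
Variable Omega : set V.
Hypothesis oOmega : open Omega.
Hypothesis cOmega : forall x y t, Omega x -> Omega y -> 0 <= t <= 1 ->
  Omega (t *: x + (1 - t) *: y).
Variable D : R.
Hypothesis bOmega : forall x, Omega x -> enorm x <= D.
Variable u : V -> R.
Hypothesis cont_u : {within closure Omega, continuous u}.
Hypothesis conv_u : forall x y t, Omega x -> Omega y -> 0 <= t <= 1 ->
  u (t *: x + (1 - t) *: y) <= t * u x + (1 - t) * u y.
Hypothesis bd_u : forall z, boundary Omega z -> u z = 0.
Implicit Types (x y z v q : V) (t s : R).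
Local Notation bd := (boundary Omega).

Lemma enorm_comb_lt x y x' y' t e : 0 <= t <= 1 ->
  enorm (x' - x) < e -> enorm (y' - y) < e ->
  enorm (t *: x' + (1 - t) *: y' - (t *: x + (1 - t) *: y)) < e.
Proof.
move=> /andP[t0 t1] xe ye; rewrite opprD addrACA -!scalerBr.
apply: le_lt_trans (enormD _ _) _; rewrite !enormZ !ger0_norm ?subr_ge0//.
have [->|t00] := eqVneq t 0; first by rewrite mul0r add0r subr0 mul1r.
apply: (@lt_le_trans _ _ (t * e + (1 - t) * e)); last by rewrite -mulrDl subrKC mul1r.
apply: ltr_leD; first by rewrite ltr_pM2l// lt_def t00.
by rewrite ler_wpM2l ?subr_ge0// ltW.
Qed.

Lemma closure_convex x y t : closure Omega x -> closure Omega y -> 0 <= t <= 1 ->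
  closure Omega (t *: x + (1 - t) *: y).
Proof.
move=> /closure_enormP cx /closure_enormP cy t01.
apply/closure_enormP => r r0.
have [x' Ox' xx'] := cx r r0; have [y' Oy' yy'] := cy r r0.
exists (t *: x' + (1 - t) *: y'); first exact: cOmega.
exact: enorm_comb_lt.
Qed.

Lemma closure_convex_function x y t :
  closure Omega x -> closure Omega y -> 0 <= t <= 1 ->
  u (t *: x + (1 - t) *: y) <= t * u x + (1 - t) * u y.
Proof.
move=> cx cy t01; apply/ler_addgt0Pr => e e0.
have e3 : 0 < e / 3 by rewrite divr_gt0.
have [r1 r10 H1] := within_continuous_enormP cont_u cx e3.
have [r2 r20 H2] := within_continuous_enormP cont_u cy e3.
have cz := closure_convex cx cy t01.
have [r3 r30 H3] := within_continuous_enormP cont_u cz e3.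
have r0 : 0 < Num.min r1 (Num.min r2 r3) by rewrite !lt_min r10 r20.
have [x' Ox' xx'] := (closure_enormP _ _).1 cx _ r0.
have [y' Oy' yy'] := (closure_enormP _ _).1 cy _ r0.
have zz' := enorm_comb_lt t01 xx' yy'.
rewrite !lt_min in xx' yy' zz'.
have Oz' := cOmega Ox' Oy' t01.
have := H1 _ (subset_closure Ox') (andP xx').1.
have := H2 _ (subset_closure Oy') (andP (andP yy').2).1.
have := H3 _ (subset_closure Oz') (andP (andP zz').2).2.
rewrite !ltr_norml => /andP[a1 a2] /andP[b1 b2] /andP[c1 c2].
have := conv_u Ox' Oy' t01; have /andP[t0 t1] := t01.
have h1 : t * u x' <= t * (u x + e / 3) by rewrite ler_wpM2l//; lra.
have h2 : (1 - t) * u y' <= (1 - t) * (u y + e / 3).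
  by rewrite ler_wpM2l//; lra.
lra.
Qed.

(** [x] lies between two boundary points, where [u] vanishes. *)
Lemma u_le0 x : Omega x -> u x <= 0.
Proof.
move=> Ox.
have v0 : (const_mx 1 : V) != 0.
  by apply/eqP => /rowP/(_ ord0); rewrite !mxE => /eqP; rewrite oner_eq0.
have [s1 s10 b1] := ray_boundary oOmega bOmega Ox v0.
have v0' : - (const_mx 1 : V) != 0 by rewrite oppr_eq0.
have [s2 s20 b2] := ray_boundary oOmega bOmega Ox v0'.
have s12 : 0 < s1 + s2 by rewrite addr_gt0.
have -> : x = (s2 / (s1 + s2)) *: (x + s1 *: const_mx 1) +
    (1 - s2 / (s1 + s2)) *: (x + s2 *: - const_mx 1).
  by apply/rowP => i; rewrite !mxE; field; rewrite gt_eqF.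
apply: le_trans (closure_convex_function b1.1 b2.1 _) _.
  by rewrite (divr_ge0 (ltW s20) (ltW s12)) ler_pdivrMr// mul1r lerDr ltW.
by rewrite !bd_u// !mulr0 addr0.
Qed.

(** On the segment from [y], where [u] is negative, through [x] to the boundary,
    convexity keeps [u] below a linear function that is negative before its
    end. *)
Lemma u_lt0 x : (exists2 y, closure Omega y & u y != 0) -> Omega x -> u x < 0.
Proof.
move=> [y cy uy] Ox.
have Oy : Omega y.
  apply: contrapT => NOy; move: uy; rewrite bd_u ?eqxx//.
  exact/(boundaryE oOmega).
have uy0 : u y < 0 by rewrite lt_neqAle uy u_le0.
have [->//|xy] := eqVneq x y.
have v0 : x - y != 0 by rewrite subr_eq0.
have [s s0 b] := ray_boundary oOmega bOmega Ox v0.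
have s10 : 0 < 1 + s by rewrite addr_gt0.
have -> : x = (s / (1 + s)) *: y + (1 - s / (1 + s)) *: (x + s *: (x - y)).
  by apply/rowP => i; rewrite !mxE; field; rewrite gt_eqF.
apply: le_lt_trans (closure_convex_function (subset_closure Oy) b.1 _) _.
  by rewrite (divr_ge0 (ltW s0) (ltW s10)) ler_pdivrMr// mul1r lerDr ler01.
by rewrite (bd_u b) mulr0 addr0 pmulr_rlt0// divr_gt0.
Qed.

Lemma u_bounded x0 : Omega x0 ->
  exists2 K, 0 <= K & forall x, Omega x -> `|u x| <= K.
Proof.
move=> Ox0.
have ne : closure Omega !=set0 by exists x0; exact: subset_closure.
have [c _ cmin] := compact_EVT_min ne (compact_closure_Omega bOmega) cont_u.
exists `|u c| => // x Ox.
have := cmin x; rewrite inE => /(_ (subset_closure Ox)) h.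
rewrite (ler0_norm (u_le0 Ox)) -normrN.
by apply: le_trans (ler_norm _); rewrite lerN2.
Qed.

(** By convexity a local minimum of [u] minus a linear function is global. *)
Lemma subdifferential_local_min x q r : Omega x -> 0 < r ->
  (forall y, Omega y -> enorm (y - x) < r -> u x + dotv q (y - x) <= u y) ->
  subdifferential Omega u x q.
Proof.
move=> Ox r0 H y Oy.
have [yx|yx] := eqVneq y x; first by rewrite yx subrr dotv0r addr0.
have yx0 : 0 < enorm (y - x) by rewrite enorm_gt0 ?subr_eq0.
pose t := Num.min 1 (r / (2 * enorm (y - x))).
have t0 : 0 < t by rewrite lt_min ltr01 divr_gt0 ?mulr_gt0.
have t1 : t <= 1 by rewrite ge_min lexx.
have t01 : 0 <= t <= 1 by rewrite ltW.
have zx : t *: y + (1 - t) *: x - x = t *: (y - x).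
  by apply/rowP => i; rewrite !mxE; ring.
have := H _ (cOmega Oy Ox t01); rewrite zx enormZ gtr0_norm// dotvZr.
have tr : t * enorm (y - x) < r.
  apply: (@le_lt_trans _ _ (r / (2 * enorm (y - x)) * enorm (y - x))).
    by rewrite ler_wpM2r ?enorm_ge0// ge_min lexx orbT.
  rewrite invfM mulrA -mulrA mulVf ?gt_eqF// mulr1; lra.
move=> /(_ tr) h; have h2 := conv_u Oy Ox t01.
rewrite -(ler_pM2l t0); lra.
Qed.

End ConvexFunction.

(** * The Monge-Ampere measure as a measure with density *)

Section MongeAmpere.
Context {R : realType} {n : nat}.
Local Notation V := 'rV[R]_n.+1.
Local Notation bV := (borel_rV R n.+1).
Local Notation lam := (@lebesgue_rV R n.+1).
Variable Omega : set V.
Hypothesis oOmega : open Omega.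
Variable D : R.
Hypothesis bOmega : forall x, Omega x -> enorm x <= D.
Variable x0 : V.
Hypothesis Ox0 : Omega x0.
Variable u : V -> R.
Hypothesis cont_u : {within closure Omega, continuous u}.
Variables (M p alpha : R).
Hypothesis M_gt0 : 0 < M.
Hypothesis heq : ma_equation Omega M p alpha u.
Local Notation bd := (boundary Omega).
Local Notation dist x := (euclid_dist x bd).
Local Notation ma := (monge_ampere Omega u).

Definition ma_density (x : bV) : \bar R :=
  (M * `|u x| `^ p * dist x `^ (- alpha))%:E.

Lemma ma_density_ge0 x : (0 <= ma_density x)%E.
Proof. by rewrite lee_fin !mulr_ge0 ?powR_ge0// ltW. Qed.

Lemma measurable_Omega : measurable (Omega : set bV).
Proof. exact: open_measurable_rV. Qed.

Lemma measurable_fun_u : measurable_fun (Omega : set bV) u.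
Proof.
move=> mO; apply: (measurability _ (RGenOpens.measurableE R)) => //.
move=> _ [_ [a [b ->] <-]]; apply: open_measurable_rV.
apply/open_enormP => x [Ox uab].
have : nbhs (u x) `]a, b[%classic.
  by apply: open_nbhs_nbhs; split; [exact: interval_open|exact: uab].
move=> /nbhs_ballP[e /= e0 He].
have [r r0 H] := within_continuous_enormP cont_u (subset_closure Ox) e0.
have [r' r'0 H'] := (open_enormP _).1 oOmega _ Ox.
exists (Num.min r r'); first by rewrite lt_min r0.
move=> y; rewrite lt_min => /andP[y1 y2]; have Oy := H' _ y2.
split => //; apply: He; rewrite -ball_normE /= distrC.
exact: H (subset_closure Oy) y1.
Qed.

Lemma measurable_fun_dist : measurable_fun (Omega : set bV) (fun x : V => dist x).
Proof.
move=> mO; apply: (measurability _ (RGenOInfty.measurableE R)) => //.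
move=> _ [_ [a ->] <-]; apply: measurableI => //.
rewrite preimage_itvoy.
rewrite (_ : [set x | _] = ~` [set x | dist x <= a]).
  apply: measurableC; apply: measurable_le_continuous.
  exact: (dist_continuous oOmega bOmega Ox0).
by apply/seteqP; split => x /=; rewrite ltNge => /negP.
Qed.

Lemma measurable_fun_abs_u : measurable_fun (Omega : set bV) (fun x => `|u x|%:E).
Proof.
by apply/measurable_EFinP; apply: measurableT_comp => //; exact: measurable_fun_u.
Qed.

Lemma measurable_ma_density : measurable_fun (Omega : set bV) ma_density.
Proof.
apply/measurable_EFinP; apply: measurable_funM.
  apply: measurable_funM => //.
  apply: (measurableT_comp (measurable_powR p)).
  by apply: measurableT_comp => //; exact: measurable_fun_u.
by apply: (measurableT_comp (measurable_powR _)); exact: measurable_fun_dist.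
Qed.

Lemma monge_ampereE (E : set bV) : measurable E ->
  ma E = (\int[lam]_(x in E `&` Omega) ma_density x)%E.
Proof.
move=> mE; rewrite -heq //; last exact: measurableI measurable_Omega.
by rewrite /monge_ampere -setIA setIid.
Qed.

Lemma monge_ampere_semi_sigma_additive : semi_sigma_additive ma.
Proof.
move=> F mF tF mUF.
have -> : ma (\bigcup_k F k) = (\sum_(k <oo) ma (F k))%E.
  rewrite monge_ampereE// setI_bigcupl.
  rewrite ge0_integral_bigcup//.
  - by apply: eq_eseriesr => k _; rewrite monge_ampereE.
  - by move=> k; apply: measurableI => //; exact: measurable_Omega.
  - apply: (measurable_funS measurable_Omega _ measurable_ma_density).
    by move=> x [k _ []].
  - by move=> x _; exact: ma_density_ge0.
  - by apply: trivIset_setIr.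
apply: is_cvg_nneseries => k _ _.
by rewrite monge_ampereE//; apply: integral_ge0 => x _; exact: ma_density_ge0.
Qed.

Lemma monge_ampere0 : ma set0 = 0%E.
Proof. by rewrite monge_ampereE// set0I integral_set0. Qed.

Lemma monge_ampere_ge0 E : (0 <= ma E)%E.
Proof. exact: lebesgue_rV_ge0. Qed.

(** Additivity of [ma] comes from the equation: by its definition [ma] is only an
    outer measure of images under the subdifferential, which may overlap, while
    the equation writes it as the integral of a density. Integrals against [ma]
    then obey the usual rules. *)
Lemma monge_ampere_measure :
  exists mu : {measure set bV -> \bar R}, (mu : set bV -> \bar R) = ma.
Proof.
pose ax := isMeasure.Build _ bV R ma monge_ampere0 monge_ampere_ge0
  monge_ampere_semi_sigma_additive.
pose mu : {measure set bV -> \bar R} := HB.pack ma ax.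
by exists mu.
Qed.

Lemma ma_energy_bigcup (F : nat -> set bV) : (forall k, measurable (F k)) ->
  trivIset setT F -> (Omega : set bV) = \bigcup_k F k ->
  ma_energy Omega u = (\sum_(k <oo) \int[ma]_(x in F k) `|u x|%:E)%E.
Proof.
move=> mF tF OF; have [mu muE] := monge_ampere_measure.
rewrite /ma_energy -muE {1}OF ge0_integral_bigcup//.
by rewrite -OF; exact: measurable_fun_abs_u.
Qed.

Lemma le_integral_ma (E : set bV) c : measurable E -> E `<=` Omega -> 0 <= c ->
  (forall x, E x -> `|u x| <= c) ->
  (\int[ma]_(x in E) `|u x|%:E <= c%:E * ma E)%E.
Proof.
move=> mE EO c0 H; have [mu muE] := monge_ampere_measure.
rewrite -muE -integral_cst//.
apply: ge0_le_integral => //.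
  exact: measurable_funS measurable_Omega EO measurable_fun_abs_u.
Qed.

Lemma ge_integral_ma (E : set bV) c : measurable E -> E `<=` Omega -> 0 <= c ->
  (forall x, E x -> c <= `|u x|) ->
  (c%:E * ma E <= \int[ma]_(x in E) `|u x|%:E)%E.
Proof.
move=> mE EO c0 H; have [mu muE] := monge_ampere_measure.
rewrite -muE -integral_cst//.
apply: ge0_le_integral => //.
  exact: measurable_funS measurable_Omega EO measurable_fun_abs_u.
Qed.

Lemma ma_energy_ge (F : nat -> set bV) N : (forall k, measurable (F k)) ->
  trivIset setT F -> (forall k, F k `<=` Omega) ->
  (\sum_(0 <= k < N) \int[ma]_(x in F k) `|u x|%:E <= ma_energy Omega u)%E.
Proof.
move=> mF tF FO; have [mu muE] := monge_ampere_measure.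
rewrite /ma_energy -muE.
apply: (@le_trans _ _ (\sum_(k <oo) \int[mu]_(x in F k) `|u x|%:E)%E).
  by apply: nneseries_lim_ge => k _ _; exact: integral_ge0.
rewrite -ge0_integral_bigcup//.
  apply: ge0_subset_integral => //; [exact: bigcup_measurable|exact: measurable_Omega|exact: measurable_fun_abs_u|].
  by move=> x [k _ /FO].
apply: (measurable_funS measurable_Omega _ measurable_fun_abs_u).
by move=> x [k _ /FO].
Qed.

Lemma monge_ampere_le (E : set bV) c : measurable E -> E `<=` Omega -> 0 <= c ->
  (forall x, E x -> M * `|u x| `^ p * dist x `^ (- alpha) <= c) ->
  (ma E <= c%:E * lam E)%E.
Proof.
move=> mE EO c0 H; rewrite monge_ampereE// (setIidl EO) -integral_cst//.
apply: ge0_le_integral => //.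
- by move=> x _; exact: ma_density_ge0.
- exact: measurable_funS measurable_Omega EO measurable_ma_density.
Qed.

Lemma monge_ampere_ge (E : set bV) c : measurable E -> E `<=` Omega -> 0 <= c ->
  (forall x, E x -> c <= M * `|u x| `^ p * dist x `^ (- alpha)) ->
  (c%:E * lam E <= ma E)%E.
Proof.
move=> mE EO c0 H; rewrite monge_ampereE// (setIidl EO) -integral_cst//.
apply: ge0_le_integral => //.
exact: measurable_funS measurable_Omega EO measurable_ma_density.
Qed.

End MongeAmpere.

(** * Inequalities for real powers *)

Section Powers.
Context {R : realType}.
Implicit Types (b r s t x : R).

(** Young's inequality for [x ^ b] and [1], with exponents [b^-1] and
    [(1 - b)^-1]. *)
Lemma powR_bernoulli b x : 0 < b <= 1 -> 0 <= x -> x `^ b <= 1 + b * (x - 1).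
Proof.
move=> /andP[b0 b1] x0.
have [->|b1'] := eqVneq b 1; first by rewrite powRr1//; lra.
have bl1 : b < 1 by rewrite lt_neqAle b1' b1.
have := @conjugate_powR R (x `^ b) 1 b^-1 (1 - b)^-1.
rewrite powR_ge0 ler01 !invr_gt0 b0 subr_gt0 bl1 !invrK => /(_ isT isT isT isT).
rewrite subrKC => /(_ erefl).
rewrite -powRrM divff ?gt_eqF// powRr1// powR1 mulr1 mul1r; lra.
Qed.

(** Writing [1 + s = w ^+ 2], the weighted arithmetic-geometric mean inequality
    for [1], [w] and [w ^+ 2] leaves a remainder proportional to
    [(w - 1) ^+ 2], which is comparable to [s ^+ 2]. The mean involves [1] and
    [w] for [b <= 1 / 2], and [w] and [w ^+ 2] otherwise. *)
Lemma powR_strictly_concave b : 0 < b < 1 -> exists2 c, 0 < c &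
  forall s, `|s| <= 2^-1 -> (1 + s) `^ b <= 1 + b * s - c * s ^+ 2.
Proof.
move=> /andP[b0 b1].
pose m := Num.min b (1 - b).
have m0 : 0 < m by rewrite lt_min b0 subr_gt0.
exists (m / 9); first by rewrite divr_gt0.
move=> s; rewrite ler_norml => /andP[s1 s2].
have s0 : 0 < 1 + s by lra.
pose w := Num.sqrt (1 + s).
have w0 : 0 < w by rewrite sqrtr_gt0.
have ww : w * w = 1 + s by rewrite -expr2 sqr_sqrtr// ltW.
have w2 : w <= 2.
  rewrite leNgt; apply/negP => h.
  have : 2 * 2 <= w * w by rewrite ler_pM// ltW.
  by lra.
have sw : s = (w - 1) * (w + 1) by lra.
have hs : s ^+ 2 / 9 <= (w - 1) ^+ 2.
  rewrite ler_pdivrMr// sw exprMn ler_wpM2l ?sqr_ge0//.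
  by rewrite -[9]/(3 * 3)%:R natrM -expr2 lerXn2r ?nnegrE//; lra.
have wp r : (1 + s) `^ r = w `^ (2 * r).
  by rewrite -ww -expr2 -powR_mulrn ?ltW// -powRrM.
suff H : (1 + s) `^ b <= 1 + b * s - m * (w - 1) ^+ 2.
  apply: le_trans H _; rewrite lerD2l lerN2 mulrAC -mulrA ler_wpM2l//.
  exact: ltW.
have mw c : m <= c -> m * (w - 1) ^+ 2 <= c * (w - 1) ^+ 2.
  by move=> h; rewrite ler_wpM2r// sqr_ge0.
have [bh|bh] := leP b 2^-1.
  have := mw b; rewrite ge_min lexx => /(_ isT) h.
  rewrite wp; apply: le_trans (@powR_bernoulli (2 * b) w _ (ltW w0)) _.
    by apply/andP; split; lra.
  have -> : s = w * w - 1 by lra.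
  rewrite expr2 in h *; lra.
have := mw (1 - b); rewrite ge_min lexx orbT => /(_ isT) h.
have -> : (1 + s) `^ b = (1 + s) * (w^-1) `^ (2 * (1 - b)).
  rewrite -[w^-1]powR_inv1 ?ltW// -powRrM mulN1r -mulrN -wp.
  rewrite -{2}(powRr1 (ltW s0)) -powRD; last by rewrite (gt_eqF s0) implybT.
  by congr (_ `^ _); ring.
have wi : 0 <= w^-1 by rewrite invr_ge0 ltW.
have bb : 0 < 2 * (1 - b) <= 1 by apply/andP; split; lra.
apply: (le_trans (ler_wpM2l (ltW s0) (powR_bernoulli bb wi))).
have -> : (1 + s) * (1 + 2 * (1 - b) * (w^-1 - 1)) =
    w * w + 2 * (1 - b) * (w - w * w).
  by rewrite -ww; field; rewrite gt_eqF.
have -> : s = w * w - 1 by lra.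
rewrite expr2 in h *; lra.
Qed.

Lemma powR_near1 b s : 0 < b < 1 -> `|s| <= 2^-1 ->
  `|(1 + s) `^ b - 1| <= `|s| /\ 2^-1 <= (1 + s) `^ b.
Proof.
move=> /andP[b0 b1]; rewrite ler_norml => /andP[s1 s2].
have s0 : 0 < 1 + s by lra.
have e1b : (1 : R) `^ b = 1 by rewrite powR1.
have [sp|sn] := leP 0 s.
  have h1 : (1 + s) `^ b <= 1 + s by apply: ler1_powR; lra.
  have h2 : 1 <= (1 + s) `^ b.
    rewrite -[leLHS]e1b; apply: ge0_ler_powR; rewrite ?nnegrE; lra.
  rewrite !ger0_norm; [split; lra|lra|lra].
have h1 : 1 + s <= (1 + s) `^ b by apply: ger1_powR; [apply/andP; split|]; lra.
have h2 : (1 + s) `^ b <= 1.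
  rewrite -[leRHS]e1b; apply: ge0_ler_powR; rewrite ?nnegrE; lra.
by rewrite !ler0_norm; [split; lra|lra|lra].
Qed.

(** The fractions [s / (s + t)] and [t / (s + t)] add up to [1] and do not
    decrease when raised to the power [b]. *)
Lemma powR_subadditive b s t : 0 < b < 1 -> 0 <= s -> 0 <= t ->
  (s + t) `^ b <= s `^ b + t `^ b.
Proof.
move=> /andP[b0 b1] s0 t0.
have [st|st] := eqVneq (s + t) 0.
  by rewrite st powR0 ?gt_eqF// addr_ge0 ?powR_ge0.
have st0 : 0 < s + t by rewrite lt_def st addr_ge0.
have H x : 0 <= x <= s + t -> x / (s + t) * (s + t) `^ b <= x `^ b.
  move=> /andP[x0 xs].
  have [->|xn] := eqVneq x 0; first by rewrite !mul0r powR_ge0.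
  have xp : 0 < x by rewrite lt_def xn.
  have xd : 0 < x / (s + t) by rewrite divr_gt0.
  rewrite -[in leRHS](divfK (lt0r_neq0 st0) x) powRM ?(ltW xd) ?(ltW st0)//.
  rewrite ler_wpM2r ?powR_ge0//; apply: ger1_powR; last exact: ltW.
  by rewrite xd ler_pdivrMr// mul1r.
have h1 : s / (s + t) * (s + t) `^ b <= s `^ b by apply: H; rewrite s0 lerDl.
have h2 : t / (s + t) * (s + t) `^ b <= t `^ b by apply: H; rewrite t0 lerDr.
apply: le_trans (lerD h1 h2); rewrite -mulrDl -mulrDl divff ?mul1r//.
Qed.

Lemma powR_holder b s t : 0 < b < 1 -> 0 <= s -> 0 <= t ->
  `|s `^ b - t `^ b| <= `|s - t| `^ b.
Proof.
move=> b01; wlog st : s t / s <= t => [H s0 t0|s0 t0].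
  have [st|/ltW ts] := leP s t; first exact: H.
  by rewrite distrC (distrC s); exact: H.
rewrite [`|s - t|]distrC [leLHS]distrC (ger0_norm (_ : 0 <= t - s)) ?subr_ge0//.
have := @powR_subadditive b s (t - s) b01 s0; rewrite subr_ge0 => /(_ st).
rewrite subrKC => h.
rewrite ger0_norm ?lerBlDl// subr_ge0 ge0_ler_powR ?nnegrE//.
by case/andP: b01 => /ltW.
Qed.

Lemma powR_exprn b x k : 0 <= x -> (x ^+ k) `^ b = (x `^ b) ^+ k.
Proof.
move=> x0; elim: k => [|k IH]; first by rewrite !expr0 powR1.
by rewrite !exprS powRM ?exprn_ge0// IH.
Qed.

Lemma powR_comparable r s t : 0 < s -> s / 2 <= t <= 2 * s ->
  t `^ r <= 2 `^ `|r| * s `^ r.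
Proof.
move=> s0 /andP[st ts].
have t0 : 0 < t by apply: lt_le_trans st; rewrite divr_gt0.
have tE : t = (t / s) * s by rewrite divfK// gt_eqF.
have y0 : 0 < t / s by rewrite divr_gt0.
rewrite [in leLHS]tE powRM ?(ltW y0) ?(ltW s0)// ler_wpM2r ?powR_ge0//.
have [r0|r0] := leP 0 r.
  rewrite ger0_norm// ge0_ler_powR ?nnegrE ?(ltW y0)//.
  by rewrite ler_pdivrMr.
rewrite ltr0_norm// -[t / s]invrK -[_^-1^-1]powR_inv1 ?invr_ge0 ?(ltW y0)//.
rewrite -powRrM mulN1r ge0_ler_powR ?nnegrE ?invr_ge0 ?(ltW y0) ?oppr_ge0 ?(ltW r0)//.
by rewrite invf_div ler_pdivrMr//; lra.
Qed.

End Powers.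

(** * The barrier *)

Section Barrier.
Context {R : realType} {n : nat}.
Local Notation V := 'rV[R]_n.+1.

(** The function [(C - |x|^2) l(x)^b], for an affine [l] with unit gradient [e],
    is strictly concave near [x0]: the factor [l^b] provides a second derivative
    of order [d^(b-2)] along [e], the factor [C - |x|^2] one of order [d^b] in
    every direction, and a large [C] absorbs the mixed terms. *)
Lemma barrier_upper_bound (b c C d : R) (e x0 : V) :
  0 < b < 1 -> 0 < c ->
  (forall s, `|s| <= 2^-1 -> (1 + s) `^ b <= 1 + b * s - c * s ^+ 2) ->
  enorm e = 1 -> 0 < d -> 1 + 4 * enorm x0 ^+ 2 <= c * (C - enorm x0 ^+ 2) ->
  exists q0 : V, forall h, `|dotv h e| <= d / 2 ->
    (C - enorm (x0 + h) ^+ 2) * (d + dotv h e) `^ b <=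
    d `^ b * (C - enorm x0 ^+ 2 + dotv q0 h - dotv h e ^+ 2 / d ^+ 2
              - enorm h ^+ 2 / 4).
Proof.
move=> b01 c0 Hc e1 d0 HC.
pose A := C - enorm x0 ^+ 2.
exists ((A * b / d) *: e - 2 *: x0) => h hd.
set s := dotv h e.
have A0 : 0 <= A.
  rewrite -(pmulr_rge0 _ c0); apply: le_trans HC.
  by rewrite addr_ge0// mulr_ge0// sqr_ge0.
pose g := s / d.
have gd : s = d * g by rewrite mulrC divfK// gt_eqF.
have g2 : `|g| <= 2^-1.
  by rewrite normrM (gtr0_norm (_ : 0 < d^-1)) ?invr_gt0// ler_pdivrMr// mulrC.
have [P1 P2] := powR_near1 b01 g2; have P3 := Hc _ g2.
have -> : (d + s) `^ b = d `^ b * (1 + g) `^ b.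
  rewrite gd -{1}[d]mulr1 -mulrDr powRM ?(ltW d0)//.
  by move: g2; rewrite ler_norml => /andP[]; lra.
set P := (1 + g) `^ b in P1 P2 P3 *.
rewrite mulrCA ler_wpM2l ?powR_ge0//.
rewrite sqr_enormD dotvBl !dotvZl (dotvC e h) -/s.
have -> : s ^+ 2 / d ^+ 2 = g ^+ 2 by rewrite gd; field; rewrite gt_eqF.
have -> : A * b / d * s = A * (b * g) by rewrite gd; field; rewrite gt_eqF.
set y := dotv x0 h; set H := enorm h.
have H0 : 0 <= H by exact: enorm_ge0.
have X0 : 0 <= enorm x0 by exact: enorm_ge0.
have yH : `|y| <= enorm x0 * H by exact: norm_dotv_le.
have mixed : - (2 * y) * (P - 1) <= H ^+ 2 / 4 + 4 * enorm x0 ^+ 2 * g ^+ 2.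
  apply: le_trans (ler_norm _) _; rewrite normrM normrN normrM ger0_norm//.
  apply: (@le_trans _ _ (2 * (enorm x0 * H) * `|g|)).
    by rewrite ler_pM ?mulr_ge0// ler_pM2l.
  have := sqr_ge0 (H / 2 - 2 * enorm x0 * `|g|).
  rewrite -[g ^+ 2]real_normK ?num_real// !expr2; lra.
have AP : A * P <= A * (1 + b * g - c * g ^+ 2) by rewrite ler_wpM2l.
have HP : H ^+ 2 * 2^-1 <= H ^+ 2 * P by rewrite ler_wpM2l// sqr_ge0.
have cA : g ^+ 2 * (1 + 4 * enorm x0 ^+ 2) <= g ^+ 2 * (c * A).
  by rewrite ler_wpM2l ?sqr_ge0.
have -> : C - (enorm x0 ^+ 2 + 2 * y + H ^+ 2) = A - 2 * y - H ^+ 2.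
  by rewrite /A; ring.
rewrite -/A; move: (g ^+ 2) (H ^+ 2) (enorm x0 ^+ 2) mixed AP HP cA => G HH X mixed AP HP cA.
lra.
Qed.

End Barrier.

(** * Boundary decay and finiteness of the energy *)

Section Topology.
Context {R : realType} {n : nat}.
Local Notation V := 'rV[R]_n.+1.

Lemma enorm_continuousP (f : V -> R) :
  (forall x e, 0 < e -> exists2 r, 0 < r &
     forall y, enorm (y - x) < r -> `|f y - f x| < e) -> continuous f.
Proof.
move=> H x B /nbhs_ballP[e /= e0 HB]; apply/nbhs_enormP.
have [r r0 Hr] := H x e e0; exists r => // y yx; apply: HB.
by rewrite -ball_normE /= distrC; exact: Hr.
Qed.

Lemma closed_le_continuous (f : V -> R) a :
  continuous f -> closed [set x | f x <= a].
Proof.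
move=> cf; rewrite (_ : [set x | _] = ~` [set x | a < f x]).
  apply: open_closedC.
  by apply: (@open_comp _ _ f [set t | a < t]) => [x _|];
    [exact: cf|exact: open_gt].
by apply/seteqP; split => x /=; rewrite leNgt => /negP.
Qed.

(** The domain is any topological space, so that it can be a subspace. *)
Lemma continuous_sub (T : topologicalType) (f g : T -> R) :
  continuous f -> continuous g -> continuous (fun x => f x - g x).
Proof. by move=> cf cg x; exact: (continuousB (cf x) (cg x)). Qed.

Lemma continuous_add (T : topologicalType) (f g : T -> R) :
  continuous f -> continuous g -> continuous (fun x => f x + g x).
Proof. by move=> cf cg x; exact: (continuousD (cf x) (cg x)). Qed.

Lemma continuous_mul (T : topologicalType) (f g : T -> R) :
  continuous f -> continuous g -> continuous (fun x => f x * g x).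
Proof. by move=> cf cg x; exact: (continuousM (cf x) (cg x)). Qed.

End Topology.

Section Plate.
Context {R : realType} {n : nat}.
Local Notation V := 'rV[R]_n.+1.
Local Notation lam := (@lebesgue_rV R n.+1).

(** Closed and centred, whereas [cyl] is half-open: minima are taken over plates,
    and volumes are computed from cylinders. *)
Definition plate (x0 e : V) (a b : R) : set V :=
  [set x | `|dotv (x - x0) e| <= a /\ enorm (perp e (x - x0)) <= b].

Variables (x0 e : V).
Hypothesis e1 : enorm e = 1.

Lemma closed_plate a b : closed (plate x0 e a b).
Proof.
apply: (@closedI _ [set x | `|dotv (x - x0) e| <= a]
  [set x | enorm (perp e (x - x0)) <= b]); apply: closed_le_continuous;
  apply: (@enorm_lip_continuous _ _ _ 1) => x y; rewrite mul1r.
  apply: le_trans (ler_dist_dist _ _) _; rewrite -dotvBl.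
  by rewrite opprB addrA subrK norm_dotv_unit_le.
apply: le_trans (enorm_lip _ _) _; rewrite -perpB.
by rewrite opprB addrA subrK enorm_perp_le.
Qed.

Lemma plate_enorm a b x : plate x0 e a b x -> enorm (x - x0) <= a + b.
Proof.
move=> [h1 h2]; apply: le_trans (enorm_le_perp e1 _) _.
by rewrite lerD.
Qed.

Lemma cyl_sub_plate a b :
  [set x | cyl e a b (x - x0)] `<=` plate x0 e a b.
Proof. by move=> x [/andP[h1 h2] h3]; split => //; rewrite ger0_norm// ltW. Qed.

Lemma plate_sub_cyl a b : 0 < a ->
  plate x0 e a b `<=` [set x | cyl e (3 * a) b (x - (x0 - a *: e))].
Proof.
move=> a0 x [h1 h2]; rewrite /cyl /= opprB addrCA [a *: e + _]addrC.
rewrite dotvDl dotvZl dotv_unit// mulr1 perpD perpZ perp_unit// scaler0 addr0.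
by split => //; move: h1; rewrite ler_norml => /andP[? ?]; apply/andP; split; lra.
Qed.

End Plate.

Section UpperBound.
Context {R : realType} {n : nat}.
Local Notation V := 'rV[R]_n.+1.
Local Notation bV := (borel_rV R n.+1).
Local Notation lam := (@lebesgue_rV R n.+1).
Variable Omega : set V.
Hypothesis oOmega : open Omega.
Hypothesis cOmega : forall x y t, Omega x -> Omega y -> 0 <= t <= 1 ->
  Omega (t *: x + (1 - t) *: y).
Variable D : R.
Hypothesis bOmega : forall x, Omega x -> enorm x <= D.
Variable x1 : V.
Hypothesis Ox1 : Omega x1.
Variable u : V -> R.
Hypothesis cont_u : {within closure Omega, continuous u}.
Hypothesis conv_u : forall x y t, Omega x -> Omega y -> 0 <= t <= 1 ->
  u (t *: x + (1 - t) *: y) <= t * u x + (1 - t) * u y.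
Hypothesis bd_u : forall z, boundary Omega z -> u z = 0.
Variables (M p alpha : R).
Hypothesis M_gt0 : 0 < M.
Hypothesis p_gt0 : 0 < p.
Hypothesis heq : ma_equation Omega M p alpha u.
Local Notation bd := (boundary Omega).
Local Notation dist x := (euclid_dist x bd).
Local Notation ma := (monge_ampere Omega u).
Let distL := dist_lip oOmega bOmega Ox1.
Let dist0 := dist_ge0 oOmega bOmega Ox1.
Let distP := dist_gt0 oOmega bOmega Ox1.
Implicit Types (x y h q e : V).

Lemma dist_le_diameter x : Omega x -> dist x <= 2 * D.
Proof.
move=> Ox; have [z bz] := bd_nonempty oOmega bOmega Ox1.
apply: le_trans (dist_le _ bz) _; apply: le_trans (enormD _ _) _.
have := closure_bounded bOmega bz.1; rewrite enormN; have := bOmega Ox; lra.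
Qed.

(** A function lying above a paraboloid that it touches at [x0] has near [x0]
    all the slopes that the paraboloid has in a suitable cylinder. The cylinder
    is flat along [e], where the paraboloid is steeper by a factor
    [(dist x0)^-2]. A slope [q] in the tube is attained where [u] minus the linear
    function of slope [q] is minimal over the cylinder: the paraboloid forces this
    minimum into the interior, where by convexity it is a global one. *)
Lemma tube_subdifferential x0 e q1 kap eta :
  Omega x0 -> enorm e = 1 -> 0 < kap -> 0 < eta -> eta <= 5^-1 ->
  eta * dist x0 <= 4^-1 ->
  (forall h, `|dotv h e| <= dist x0 / 2 -> Omega (x0 + h) ->
     u x0 + dotv q1 h + kap * (dotv h e ^+ 2 / dist x0 ^+ 2 + enorm h ^+ 2 / 4)
       <= u (x0 + h)) ->
  plate q1 e (kap * eta / 2) (kap * eta ^+ 2 * dist x0) `<=`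
  \bigcup_(x in plate x0 e (eta * dist x0 ^+ 2) (dist x0 / 4) `&` Omega)
     subdifferential Omega u x.
Proof.
move=> Ox0 e1 kap0 eta0 eta5 etad Hu q [hq1 hq2].
set d := dist x0 in etad Hu hq2 *; have d0 : 0 < d := distP Ox0.
set Z := plate x0 e (eta * d ^+ 2) (d / 4).
have etad2 : eta * d ^+ 2 <= d / 4.
  by rewrite expr2 mulrA mulrC ler_pM2l.
have ZO : Z `<=` Omega.
  move=> x /(plate_enorm e1) xx0; apply: (dist_ball oOmega Ox0).
  by apply: le_lt_trans xx0 _; rewrite -/d; lra.
have Z0 : Z x0.
  split; rewrite subrr.
    by rewrite dotv0l normr0 (mulr_ge0 (ltW eta0) (sqr_ge0 _)).
  by rewrite /perp dotv0l scale0r subrr enorm0 (divr_ge0 (ltW d0)).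
have cZ : compact Z.
  apply: (compact_enorm (r := D)); first exact: closed_plate.
  by move=> x /ZO /bOmega.
have cF : {within Z, continuous (fun x => u x - dotv x q)}.
  have cF' : {within closure Omega, continuous (fun x => u x - dotv x q)}.
    apply: (@continuous_sub _ (subspace (closure Omega)) u (fun x => dotv x q)).
      exact: cont_u.
    have cq : {within closure Omega, continuous (fun x : V => dotv x q)}.
      exact/continuous_subspaceT/dotv_continuous.
    exact: cq.
  apply: continuous_subspaceW cF' => x /ZO; exact: subset_closure.
have [x Zx xmin] := compact_EVT_min (ex_intro _ _ Z0) cZ cF.
rewrite inE in Zx.
have min0 := xmin x0; rewrite inE in min0; move: (min0 Z0) => {}min0.
have [hx1 hx2] := Zx.
set h := x - x0 in hx1 hx2.
have xE : x = x0 + h by rewrite /h addrC subrK.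
have hu : u x0 + dotv q1 h + kap * (dotv h e ^+ 2 / d ^+ 2 + enorm h ^+ 2 / 4) <= u x.
  rewrite [in leRHS]xE; apply: Hu; last by rewrite -xE; exact: ZO.
  by apply: le_trans hx1 _; lra.
have key : kap * (dotv h e ^+ 2 / d ^+ 2 + enorm h ^+ 2 / 4) <= dotv (q - q1) h.
  have : dotv x q = dotv x0 q + dotv h q by rewrite {1}xE dotvDl.
  rewrite dotvBl (dotvC q h); lra.
have key2 : dotv (q - q1) h <=
    kap * eta / 2 * `|dotv h e| + kap * eta ^+ 2 * d * enorm (perp e h).
  rewrite (dotv_splitE e1); apply: lerD.
    by apply: le_trans (ler_norm _) _; rewrite normrM ler_wpM2r.
  by apply: le_trans (dotv_le _ _) _; rewrite ler_wpM2r ?enorm_ge0.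
have hs2 : enorm h ^+ 2 = dotv h e ^+ 2 + enorm (perp e h) ^+ 2.
  exact: sqr_enorm_perp.
(* In the units [sg = |dotv h e| / d^2], [Y = |perp e h| / d] both sides of the
   comparison are multiples of [kap * d^2]. *)
pose sg := `|dotv h e| / d ^+ 2; pose Y := enorm (perp e h) / d.
have sgE : `|dotv h e| = sg * d ^+ 2 by rewrite divfK// gt_eqF// exprn_gt0.
have YE : enorm (perp e h) = Y * d by rewrite divfK// gt_eqF.
have sg0 : 0 <= sg by rewrite divr_ge0// sqr_ge0.
have Y0 : 0 <= Y by rewrite divr_ge0 ?enorm_ge0// ltW.
have d20 : 0 < d ^+ 2 by rewrite exprn_gt0.
have main : sg ^+ 2 + Y ^+ 2 / 4 <= eta / 2 * sg + eta ^+ 2 * Y.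
  have kd : 0 < kap * d ^+ 2 by rewrite mulr_gt0.
  rewrite -(ler_pM2l kd).
  have := le_trans key key2; rewrite hs2 sgE YE.
  rewrite -[dotv h e ^+ 2]real_normK ?num_real// sgE => H.
  have e1' : (sg * d ^+ 2) ^+ 2 / d ^+ 2 = sg ^+ 2 * d ^+ 2.
    by field; rewrite gt_eqF.
  rewrite e1' in H.
  have : 0 <= kap * (sg * d ^+ 2) ^+ 2 by rewrite mulr_ge0 ?sqr_ge0 ?(ltW kap0).
  rewrite exprMn in H *; lra.
(* On either part of the boundary of the cylinder, [sg = eta] or [Y = 1 / 4],
   the inequality [main] fails because [eta] is small. *)
have sgle : sg <= eta by rewrite ler_pdivrMr.
have Yle : Y <= 4^-1 by rewrite ler_pdivrMr// mulrC.
have sglt : sg < eta.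
  rewrite lt_neqAle sgle andbT; apply/eqP => sgeta; move: main; rewrite sgeta.
  have : 0 < eta ^+ 2 by rewrite exprn_gt0.
  have h1 : eta ^+ 2 * Y <= eta ^+ 2 * 4^-1 by rewrite ler_wpM2l// sqr_ge0.
  by have := sqr_ge0 Y; rewrite !expr2 in h1 *; lra.
have Ylt : Y < 4^-1.
  rewrite lt_neqAle Yle andbT; apply/eqP => Yq; move: main; rewrite Yq.
  have := sqr_ge0 (sg - eta / 4).
  have : eta ^+ 2 <= 5^-1 ^+ 2 by rewrite lerXn2r ?nnegrE ?(ltW eta0) ?invr_ge0.
  rewrite !expr2; lra.
exists x; first by split => //; exact: ZO.
pose r := Num.min (eta * d ^+ 2 - `|dotv h e|) (d / 4 - enorm (perp e h)).
apply: (subdifferential_local_min cOmega conv_u (ZO _ Zx) (r := r)).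
  rewrite lt_min !subr_gt0 sgE YE ltr_pM2r// sglt /=.
  by rewrite [d / 4]mulrC ltr_pM2r.
move=> y Oy; rewrite lt_min => /andP[y1 y2].
have yE : y - x0 = (y - x) + h by rewrite /h addrA subrK.
have Zy : Z y.
  split; rewrite yE.
    rewrite dotvDl; apply: le_trans (ler_normD _ _) _.
    have := norm_dotv_unit_le e1 (y - x); lra.
  rewrite perpD; apply: le_trans (enormD _ _) _.
  have := enorm_perp_le e1 (y - x); lra.
have := xmin y; rewrite inE => /(_ Zy).
rewrite dotvBr (dotvC q y) (dotvC q x); lra.
Qed.

Definition decay (g : R) := exists2 K, 0 < K &
  forall x, Omega x -> `|u x| <= K * dist x `^ g.

Lemma density_le K g x : 0 < K -> (forall x, Omega x -> `|u x| <= K * dist x `^ g) ->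
  Omega x -> M * `|u x| `^ p * dist x `^ (- alpha) <=
             M * K `^ p * dist x `^ (p * g - alpha).
Proof.
move=> K0 HK Ox; have d0 := distP Ox.
have -> : dist x `^ (p * g - alpha) = (dist x `^ g) `^ p * dist x `^ (- alpha).
  by rewrite powRD ?(gt_eqF d0) ?implybT// -powRrM (mulrC g).
rewrite !mulrA ler_wpM2r ?powR_ge0// -mulrA ler_pM2l//.
rewrite -powRM ?powR_ge0 ?(ltW K0)//.
apply: ge0_ler_powR; rewrite ?nnegrE ?mulr_ge0 ?powR_ge0 ?(ltW K0) ?(ltW p_gt0)//.
exact: HK.
Qed.

Lemma dist_powR_continuous b : 0 < b < 1 -> continuous (fun x => dist x `^ b).
Proof.
move=> b01; have /andP[b0 b1] := b01.
apply: enorm_continuousP => x e e0; exists (e `^ b^-1); first exact: powR_gt0.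
move=> y yx; apply: le_lt_trans (powR_holder b01 (dist0 _) (dist0 _)) _.
have -> : e = (e `^ b^-1) `^ b.
  by rewrite -powRrM mulVf ?gt_eqF// powRr1// ltW.
apply: gt0_ltr_powR; rewrite ?nnegrE ?powR_ge0//.
exact: le_lt_trans (distL y x) yx.
Qed.

(** If [u] decays like [dist^g], its Monge-Ampere density near [x0] is at most of
    order [dist^(p g - alpha)]. The slopes of a paraboloid touching [u] from
    below at [x0] fill a tube of volume comparable to [kap^(n+1) dist^n], and
    they are slopes of [u] in a cylinder of volume comparable to [dist^(n+2)];
    comparing the two bounds the opening [kap]. *)
Lemma touching_paraboloid_bound g K0 : 0 < K0 ->
  (forall x, Omega x -> `|u x| <= K0 * dist x `^ g) ->
  exists2 C, 0 < C & forall x0 e q1 (kap : R), Omega x0 -> enorm e = 1 -> 0 < kap ->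
    (forall h, `|dotv h e| <= dist x0 / 2 -> Omega (x0 + h) ->
       u x0 + dotv q1 h + kap * (dotv h e ^+ 2 / dist x0 ^+ 2 + enorm h ^+ 2 / 4)
       <= u (x0 + h)) ->
    kap ^+ n.+1 <= C * dist x0 `^ (p * g - alpha + 2).
Proof.
move=> K00 HK0.
have [cl [cu [cl0 cu0 Hcyl]]] := @cyl_volume R n.
have D0 : 0 <= D := le_trans (enorm_ge0 _) (bOmega Ox1).
have lowE (eta kap d : R) : cl * (kap * eta / 2) * (kap * eta ^+ 2 * d) ^+ n =
    cl * (eta / 2) * (eta ^+ 2) ^+ n * kap ^+ n.+1 * d ^+ n.
  by rewrite (exprMn _ _ d) (exprMn _ kap) [kap ^+ n.+1]exprS; ring.
have upE (L A B eta d : R) :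
    L * (A * B) * (cu * (3 * (eta * d ^+ 2)) * (d / 4) ^+ n) =
    L * A * (cu * (3 * eta) * 4^-1 ^+ n) * (B * d ^+ 2) * d ^+ n.
  by rewrite (exprMn _ d); ring.
have half (a d : R) : a <= d / 4 -> a + d / 4 <= d / 2 by lra.
have halflt (d : R) : 0 < d -> d / 2 < d by lra.
have near (d t k : R) : - k <= t - d <= k -> k <= d / 2 -> 0 < d ->
    d / 2 <= t <= 2 * d.
  by move=> /andP[? ?] ? ?; apply/andP; split; lra.
have [eta eta0 [eta5 etaD]] : exists2 eta : R, 0 < eta &
    eta <= 5^-1 /\ forall x, Omega x -> eta * dist x <= 4^-1.
  pose D' := 2 * D + 1; have D'1 : 1 <= D' by rewrite /D'; lra.
  have D'0 : 0 < D' by lra.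
  exists (5 * D')^-1; first by rewrite invr_gt0 mulr_gt0.
  split; first by rewrite lef_pV2 ?posrE ?mulr_gt0//; lra.
  move=> x Ox; rewrite ler_pdivrMl ?mulr_gt0//.
  have : dist x <= D' by have := dist_le_diameter Ox; rewrite /D'; lra.
  by lra.
pose r := p * g - alpha.
pose a1 := cl * (eta / 2) * (eta ^+ 2) ^+ n.
pose a2 := M * K0 `^ p * 2 `^ `|r| * (cu * (3 * eta) * 4^-1 ^+ n).
have a10 : 0 < a1.
  by apply: mulr_gt0; [apply: mulr_gt0 => //; exact: divr_gt0|rewrite !exprn_gt0].
have MK0 : 0 < M * K0 `^ p by rewrite mulr_gt0// powR_gt0.
have a20 : 0 < a2.
  apply: mulr_gt0; first by rewrite mulr_gt0// powR_gt0.
  by apply: mulr_gt0; [rewrite !mulr_gt0|rewrite exprn_gt0].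
exists (a2 / a1); first exact: divr_gt0.
move=> x0 e q1 kap Ox0 e1 kap0 Hu.
have incl := @tube_subdifferential x0 e q1 kap eta Ox0 e1 kap0 eta0 eta5
  (etaD _ Ox0) Hu.
have d0 : 0 < dist x0 := distP Ox0.
have etad : eta * dist x0 <= 4^-1 := etaD _ Ox0.
move: (dist x0) (distL ^~ x0) d0 etad incl (@dist_ball _ _ _ oOmega x0 ^~ Ox0)
  => d dL d0 etad incl ball.
set Z := plate x0 e _ _ in incl.
set T := plate q1 e _ _ in incl.
have etad2 : eta * d ^+ 2 <= d / 4.
  by rewrite expr2 mulrA mulrC ler_pM2l.
have Zd y : Z y -> enorm (y - x0) <= d / 2.
  by move=> /(plate_enorm e1)/le_trans; apply; exact: half.
have ZO : Z `<=` Omega.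
  by move=> y /Zd h; apply: ball; apply: le_lt_trans h _; exact: halflt.
have mZ : measurable (Z : set bV).
  by apply: closed_measurable_rV; exact: closed_plate.
have low : ((cl * (kap * eta / 2) * (kap * eta ^+ 2 * d) ^+ n)%:E <= lam T)%E.
  have k1 : 0 < kap * eta / 2 by rewrite divr_gt0// mulr_gt0.
  have k2 : 0 < kap * eta ^+ 2 * d by rewrite mulr_gt0// mulr_gt0// exprn_gt0.
  have /andP[h1 _] := Hcyl e _ _ e1 k1 k2.
  apply: le_trans h1 _; rewrite -[leLHS](lebesgue_rV_translate q1).
  by apply: le_lebesgue_rV; exact: cyl_sub_plate.
have up : (lam Z <= (cu * (3 * (eta * d ^+ 2)) * (d / 4) ^+ n)%:E)%E.
  have k1 : 0 < eta * d ^+ 2 by rewrite mulr_gt0// exprn_gt0.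
  have k2 : 0 < 3 * (eta * d ^+ 2) by rewrite mulr_gt0.
  have k3 : 0 < d / 4 by rewrite divr_gt0.
  have /andP[_ h1] := Hcyl e _ _ e1 k2 k3.
  apply: le_trans h1.
  rewrite -[leRHS](lebesgue_rV_translate (x0 - (eta * d ^+ 2) *: e)).
  by apply: le_lebesgue_rV; exact: plate_sub_cyl.
pose f := M * K0 `^ p * (2 `^ `|r| * d `^ r).
have f0 : 0 <= f by rewrite mulr_ge0 ?(ltW MK0)// mulr_ge0 ?powR_ge0.
have dens : (ma Z <= f%:E * lam Z)%E.
  apply: (monge_ampere_le oOmega bOmega Ox1 cont_u M_gt0 heq mZ ZO f0).
  move=> y Zy; apply: le_trans (density_le K00 HK0 (ZO _ Zy)) _.
  rewrite ler_pM2l//; apply: powR_comparable => //.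
  by apply: (near _ _ (enorm (y - x0))) => //; [rewrite -ler_norml dL|exact: Zd].
have TZ : (lam T <= ma Z)%E by apply: le_lebesgue_rV.
have fup : (f%:E * lam Z <= (f * (cu * (3 * (eta * d ^+ 2)) * (d / 4) ^+ n))%:E)%E.
  by rewrite [leRHS]EFinM; apply: lee_wpmul2l.
have := le_trans (le_trans (le_trans low TZ) dens) fup; rewrite lee_fin.
have -> : cl * (kap * eta / 2) * (kap * eta ^+ 2 * d) ^+ n =
    a1 * kap ^+ n.+1 * d ^+ n.
  exact: lowE.
have -> : f * (cu * (3 * (eta * d ^+ 2)) * (d / 4) ^+ n) =
    a2 * (d `^ r * d ^+ 2) * d ^+ n.
  exact: upE.
rewrite ler_pM2r ?exprn_gt0// => H.
rewrite mulrAC ler_pdivlMr// mulrC; apply: le_trans H _.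
rewrite ler_pM2l// -(powR_mulrn 2 (ltW d0)) -powRD//.
by rewrite (gt_eqF d0) implybT.
Qed.

(** The barrier [- K (C - |x|^2) dist^b] lies below [u] for large [K]: where
    [u] minus the barrier has a negative minimum, [u] is touched from below by
    a paraboloid of opening [K dist^b], more than the slopes of [u] allow. The
    minimum is not on the boundary, where both functions vanish. *)
Lemma decay_improve g b : decay g -> 0 < b < 1 ->
  n.+1%:R * b <= p * g - alpha + 2 -> decay b.
Proof.
have comb (U U' X A Q S H k : R) : U + k * A <= U' + X ->
    X <= k * (A + Q - S - H / 4) -> U - k * Q + k * (S + H / 4) <= U'.
  lra.
move=> [K0 K00 HK0] b01 hb; have /andP[b0 b1] := b01.
have [c c0 Hc] := powR_strictly_concave b01.
have [C3 C30 HC3] := touching_paraboloid_bound K00 HK0.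
have D0 : 0 <= D := le_trans (enorm_ge0 _) (bOmega Ox1).
pose D' := 2 * D + 1; have D'0 : 0 < D' by rewrite /D'; lra.
have distD x : Omega x -> dist x <= D'.
  by move=> /dist_le_diameter; rewrite /D'; lra.
pose C := D ^+ 2 + (1 + 4 * D ^+ 2) / c.
have HC x : enorm x <= D -> 1 + 4 * enorm x ^+ 2 <= c * (C - enorm x ^+ 2).
  move=> xD; have x2 : enorm x ^+ 2 <= D ^+ 2.
    by rewrite lerXn2r ?nnegrE ?enorm_ge0.
  apply: (@le_trans _ _ (c * ((1 + 4 * D ^+ 2) / c))).
    by rewrite [leRHS]mulrC divfK ?gt_eqF//; lra.
  by rewrite ler_pM2l// /C; lra.
have C0 : 0 < C.
  by rewrite ltr_wpDl ?sqr_ge0// divr_gt0// ltr_wpDr// mulr_ge0// sqr_ge0.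
have CB x : enorm x <= D -> 0 <= C - enorm x ^+ 2 <= C.
  move=> /HC h; rewrite lerBlDr lerDl sqr_ge0 andbT -(pmulr_rge0 _ c0).
  by apply: le_trans h; rewrite addr_ge0// mulr_ge0// sqr_ge0.
pose om := p * g - alpha + 2 - n.+1%:R * b.
have om0 : 0 <= om by rewrite subr_ge0.
have [K K1 KN] : exists2 K, 1 <= K & C3 * D' `^ om < K ^+ n.+1.
  have X0 : 0 <= C3 * D' `^ om by rewrite mulr_ge0 ?powR_ge0 ?(ltW C30).
  have K1 : 1 <= 1 + C3 * D' `^ om by rewrite lerDl.
  exists (1 + C3 * D' `^ om) => //.
  by apply: (@lt_le_trans _ _ (1 + C3 * D' `^ om)); rewrite ?ltrDr// ler_eXnr.
have Kp : 0 < K by apply: lt_le_trans K1.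
exists (K * C); first by rewrite mulr_gt0.
move=> x Ox; rewrite leNgt; apply/negP => Hx.
have u_neg := u_le0 oOmega cOmega bOmega cont_u conv_u bd_u.
rewrite (ler0_norm (u_neg _ Ox)) in Hx.
pose G y := u y + K * ((C - enorm y ^+ 2) * dist y `^ b).
have cG : {within closure Omega, continuous G}.
  have cn2 : continuous (fun y : V => enorm y ^+ 2).
    rewrite (_ : (fun y : V => _) = (fun y : V => enorm y * enorm y)).
      by apply: continuous_mul; exact: enorm_continuous.
    by apply/funext => z; rewrite expr2.
  have cg : continuous (fun y => K * ((C - enorm y ^+ 2) * dist y `^ b)).
    apply: continuous_mul; first exact: cst_continuous.
    apply: continuous_mul; last exact: dist_powR_continuous.
    by apply: continuous_sub; [exact: cst_continuous|exact: cn2].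
  apply: (@continuous_add _ (subspace (closure Omega)) u); first exact: cont_u.
  exact: continuous_subspaceT cg.
have [x0 cx0 x0min] := compact_EVT_min
  (ex_intro _ _ (subset_closure Ox1)) (compact_closure_Omega bOmega) cG.
rewrite inE in cx0.
have Gx0 : G x0 < 0.
  have := x0min x; rewrite inE => /(_ (subset_closure Ox)) h.
  apply: le_lt_trans h _; rewrite /G -ltrBrDr sub0r.
  apply: (@lt_le_trans _ _ (- (K * C * dist x `^ b))); first by rewrite ltrNr.
  rewrite lerN2 -mulrA ler_pM2l// ler_wpM2r ?powR_ge0//.
  by case/andP: (CB _ (bOmega Ox)).
have Ox0 : Omega x0.
  apply: contrapT => NO; have b_x0 : bd x0 by exact/(boundaryE oOmega).
  move: Gx0; rewrite /G (bd_u b_x0) (dist_boundary oOmega bOmega Ox1 b_x0).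
  by rewrite powR0 ?gt_eqF// !mulr0 addr0 ltxx.
have [e e1 He] := support_dist oOmega cOmega bOmega Ox1 Ox0.
have d0 : 0 < dist x0 := distP Ox0.
have [q0 Hq0] := barrier_upper_bound b01 c0 Hc e1 d0 (HC _ (bOmega Ox0)).
have := HC3 x0 e _ (K * dist x0 `^ b) Ox0 e1.
move=> /(_ (- (K * dist x0 `^ b) *: q0)) bound.
have {}bound : (K * dist x0 `^ b) ^+ n.+1 <= C3 * dist x0 `^ (p * g - alpha + 2).
  apply: bound; first by rewrite mulr_gt0// powR_gt0.
  move=> h hd Oh.
  have := x0min (x0 + h); rewrite inE => /(_ (subset_closure Oh)); rewrite /G => h1.
  have h2 : (C - enorm (x0 + h) ^+ 2) * dist (x0 + h) `^ b <=
      (C - enorm (x0 + h) ^+ 2) * (dist x0 + dotv h e) `^ b.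
    rewrite ler_wpM2l//; first by case/andP: (CB _ (bOmega Oh)).
    have := He _ Oh; rewrite addrAC subrr add0r => h3.
    apply: ge0_ler_powR => //; rewrite ?nnegrE ?(ltW b0)//.
    exact: le_trans h3.
  have kapE A : K * dist x0 `^ b * A = K * (dist x0 `^ b * A) by rewrite mulrA.
  rewrite dotvZl mulNr; apply: (@comb _ _
    (K * ((C - enorm (x0 + h) ^+ 2) * dist (x0 + h) `^ b)) (C - enorm x0 ^+ 2)).
    by rewrite kapE [dist x0 `^ b * _]mulrC.
  by rewrite kapE ler_pM2l//; exact: le_trans h2 (Hq0 _ hd).
move: bound; apply/negP; rewrite -ltNge.
have -> : dist x0 `^ (p * g - alpha + 2) = dist x0 `^ om * dist x0 `^ (n.+1%:R * b).
  rewrite -powRD; first by rewrite /om subrK.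
  by rewrite (gt_eqF d0) implybT.
have -> : (K * dist x0 `^ b) ^+ n.+1 = K ^+ n.+1 * dist x0 `^ (n.+1%:R * b).
  by rewrite exprMn -(powR_mulrn n.+1 (powR_ge0 _ _)) -powRrM (mulrC b).
rewrite mulrA ltr_pM2r ?powR_gt0//; apply: le_lt_trans KN.
rewrite ler_pM2l//; apply: ge0_ler_powR; rewrite ?nnegrE ?(ltW D'0)//.
exact: distD.
Qed.

(** By [decay_improve] a decay exponent [g] improves to
    [f g = (2 - alpha + p g) / (n + 1)], as long as this is below [1]. The
    hypotheses say that the affine map [f] exceeds the identity at [0] and at the
    critical exponent [(alpha - 1) / (p + 1)], hence uniformly in between, so
    finitely many improvements pass the critical exponent. *)
Lemma decay_supercritical : 0 <= alpha < 2 ->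
  (alpha - 1) * n.+1%:R - 2 < p - alpha ->
  exists g, [/\ 0 <= g, decay g & alpha - 1 < g * (p + 1)].
Proof.
move=> /andP[al0 al2] hpa.
have p10 : 0 < p + 1 by rewrite addr_gt0.
pose N : R := n.+1%:R; have N0 : 0 < N by rewrite ltr0n.
pose t := (alpha - 1) / (p + 1); pose t' := Num.max t 0.
have t'0 : 0 <= t' by rewrite le_max lexx orbT.
have tp : t * (p + 1) = alpha - 1 by rewrite divfK// gt_eqF.
have t'1 : t' < 1.
  by rewrite gt_max ltr01 andbT ltr_pdivrMr//; have := p_gt0; lra.
pose f g := (2 - alpha + p * g) / N.
have fN g : f g * N = 2 - alpha + p * g by rewrite divfK// gt_eqF.
have f0 : 0 < f 0 by rewrite divr_gt0//; lra.
have ft : 0 < f t' - t'.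
  rewrite /t'; have [tn|tpos] := leP t 0; first by rewrite subr0.
  rewrite subr_gt0 -(ltr_pM2r N0) fN -(ltr_pM2r p10).
  have -> : (2 - alpha + p * t) * (p + 1) =
      (2 - alpha) * (p + 1) + p * (t * (p + 1)) by ring.
  rewrite mulrAC tp.
  by move: hpa; rewrite -/N; lra.
pose de := Num.min (f 0) (f t' - t').
have de0 : 0 < de by rewrite lt_min f0.
have fde g : 0 <= g <= t' -> g + de <= f g.
  move=> /andP[g0 gt].
  have d1 : de <= f 0 by rewrite ge_min lexx.
  have d2 : de <= f t' - t' by rewrite ge_min lexx orbT.
  have [t'z|t'n] := eqVneq t' 0.
    have -> : g = 0 by apply/eqP; rewrite eq_le g0 -t'z gt.
    by rewrite add0r.
  have t'p : 0 < t' by rewrite lt_def t'n.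
  rewrite -(ler_pM2l t'p).
  have -> : t' * f g = (t' - g) * f 0 + g * f t'.
    by rewrite /f; field; rewrite gt_eqF.
  have h1 : (t' - g) * de <= (t' - g) * f 0 by rewrite ler_wpM2l// subr_ge0.
  have h2 : g * de <= g * (f t' - t') by rewrite ler_wpM2l.
  lra.
pose T := (1 + t') / 2.
have T1 : T < 1 by rewrite /T; lra.
have tT : t' < T by rewrite /T; lra.
have decay0 : decay 0.
  have [K K0 HK] := u_bounded oOmega cOmega bOmega cont_u conv_u bd_u Ox1.
  exists (K + 1); first by rewrite ltr_wpDl.
  by move=> x Ox; rewrite powRr0 mulr1 (le_trans (HK _ Ox))// lerDl.
have step g : 0 <= g <= t' -> decay g -> decay (Num.min T (g + de)).
  move=> g01 dg; have /andP[g0 gt] := g01.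
  have b0 : 0 < Num.min T (g + de).
    by rewrite lt_min (le_lt_trans t'0 tT) ltr_wpDl.
  apply: (decay_improve dg).
    by rewrite b0 gt_min T1.
  have : Num.min T (g + de) <= f g.
    by apply: le_trans (fde _ g01); rewrite ge_min lexx orbT.
  rewrite -(ler_pM2r N0) fN -/N mulrC; lra.
have iter k : (exists2 g, t' < g & decay g) \/
    (decay (k%:R * de) /\ k%:R * de <= t').
  elim: k => [|k [IH|[IH1 IH2]]]; [by right; rewrite mul0r|by left|].
  have k0 : 0 <= k%:R * de <= t' by rewrite IH2 andbT mulr_ge0// ltW.
  have := step _ k0 IH1.
  have [tb|tb] := ltP t' (Num.min T (k%:R * de + de)).
    by left; exists (Num.min T (k%:R * de + de)).
  move: tb; rewrite ge_min leNgt tT /= => tb.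
  rewrite min_r; last by rewrite (le_trans tb)// ltW.
  by right; rewrite -natr1 mulrDl mul1r.
have [k hk] : exists k : nat, t' < k%:R * de.
  exists (Num.truncn (t' / de)).+1.
  by rewrite -ltr_pdivrMr// truncnS_gt.
have [[g gt dg]|[_ h]] := iter k; last by have := lt_le_trans hk h; rewrite ltxx.
exists g; split => //; first exact: le_trans (ltW gt).
rewrite -tp ltr_pM2r//; apply: le_lt_trans gt.
by rewrite le_max lexx.
Qed.

(** The layer where the distance to the boundary is comparable to [t] has volume
    [O(t)] and Monge-Ampere density [O(t^(p g - alpha))], so it contributes
    [O(t^(g + p g - alpha + 1))] to the energy. The exponent is positive and the
    contributions of the dyadic layers are summable. *)
Lemma decay_energy_finite g : 0 <= g -> decay g -> alpha - 1 < g * (p + 1) ->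
  (ma_energy Omega u < +oo)%E.
Proof.
move=> g0 [K K0 HK] hg.
have [C0 C00 HC0] := boundary_layer_volume oOmega cOmega bOmega Ox1.
have D0 : 0 <= D := le_trans (enorm_ge0 _) (bOmega Ox1).
pose T := 2 * D + 1; have T0 : 0 < T by rewrite /T; lra.
have distT x : Omega x -> dist x <= T.
  by move=> /dist_le_diameter; rewrite /T; lra.
pose tau k : R := T * 2^-1 ^+ k.
have tau0 k : 0 < tau k by rewrite mulr_gt0// exprn_gt0.
have tauS k : tau k.+1 = tau k / 2 by rewrite /tau exprSr mulrA.
have tau_le i j : (i <= j)%N -> tau j <= tau i.
  by move=> ij; rewrite ler_pM2l// ler_wiXn2l//; lra.
pose F k : set bV := [set x | Omega x /\ (tau k.+1 < dist x <= tau k)].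
have mle t : measurable ([set x | dist x <= t] : set bV).
  by apply: measurable_le_continuous; exact: (dist_continuous oOmega bOmega Ox1).
have mF k : measurable (F k).
  rewrite (_ : F k = Omega `&` ([set x | dist x <= tau k] `\` [set x | dist x <= tau k.+1])).
    by apply: measurableI; [exact: open_measurable_rV|exact: measurableD].
  apply/seteqP; split => x.
    by move=> [Ox /andP[h1 h2]]; split => //; split => //=; apply/negP; rewrite -ltNge.
  by move=> [Ox [h2 /negP]]; rewrite -ltNge => h1; split => //; rewrite h1.
have FO k : F k `<=` Omega by move=> x [].
have tF : trivIset setT F.
  have H i j x : (i < j)%N -> F i x -> F j x -> False.
    move=> ij [_ /andP[h1 _]] [_ /andP[_ h2]].
    by have := lt_le_trans h1 (le_trans h2 (tau_le _ _ ij)); rewrite ltxx.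
  apply/trivIsetP => i j _ _ ij; apply/seteqP; split => x // -[Fi Fj].
  by move: ij; rewrite neq_ltn => /orP[] ij; [exact: (H i j x)|exact: (H j i x)].
have OF : (Omega : set bV) = \bigcup_k F k.
  apply/seteqP; split => x; last by move=> [k _ /FO].
  move=> Ox; have d0 := distP Ox.
  have ex : exists k, tau k.+1 < dist x.
    pose k := Num.truncn (T / dist x).
    exists k; rewrite /tau exprVn ltr_pdivrMr ?exprn_gt0// mulrC -ltr_pdivrMr//.
    apply: lt_le_trans (truncnS_gt _) _; rewrite -/k -natrX ler_nat.
    by rewrite ltnW// ltn_expl.
  case: (ex_minnP ex) => k hk kmin; exists k => //; split => //; rewrite hk /=.
  case: k hk kmin => [|k] hk kmin; first by rewrite /tau expr0 mulr1 distT.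
  rewrite leNgt; apply/negP => /kmin; by rewrite ltnn.
pose r := p * g - alpha.
pose om := g + r + 1.
have om0 : 0 < om by rewrite /om /r; lra.
pose B := K * (M * K `^ p * 2 `^ `|r|) * (C0 * 2).
have B0 : 0 <= B.
  rewrite /B mulr_ge0 ?mulr_ge0 ?powR_ge0 ?(ltW K0) ?(ltW M_gt0)//.
pose z : R := 2^-1 `^ om.
have z0 : 0 < z by apply: powR_gt0.
have z1 : z < 1.
  have e1b : (1 : R) `^ om = 1 by rewrite powR1.
  by rewrite -e1b; apply: gt0_ltr_powR; rewrite ?nnegrE//; lra.
have term k : (\int[ma]_(x in F k) `|u x|%:E <= (B * T `^ om * z ^+ k)%:E)%E.
  have kg : 0 <= K * tau k `^ g by rewrite mulr_ge0 ?powR_ge0 ?(ltW K0).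
  have h1 : (\int[ma]_(x in F k) `|u x|%:E <= (K * tau k `^ g)%:E * ma (F k))%E.
    apply: (le_integral_ma oOmega bOmega Ox1 cont_u M_gt0 heq (mF k) (FO k) kg).
    move=> x [Ox /andP[_ dx]]; apply: le_trans (HK _ Ox) _.
    by rewrite ler_pM2l// ge0_ler_powR ?nnegrE ?(ltW (tau0 _))// dist0.
  pose f := M * K `^ p * (2 `^ `|r| * tau k `^ r).
  have f0 : 0 <= f by rewrite !mulr_ge0 ?powR_ge0 ?(ltW M_gt0).
  have h2 : (ma (F k) <= f%:E * lam (F k))%E.
    apply: (monge_ampere_le oOmega bOmega Ox1 cont_u M_gt0 heq (mF k) (FO k) f0).
    move=> x [Ox /andP[d1 d2]]; apply: le_trans (density_le K0 HK Ox) _.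
    rewrite ler_pM2l; last by rewrite mulr_gt0// powR_gt0.
    apply: powR_comparable => //; rewrite tauS in d1; rewrite (ltW d1) /=.
    by apply: le_trans d2 _; have := tau0 k; lra.
  have h3 : (lam (F k) <= (C0 * (2 * tau k))%:E)%E.
    apply: le_trans (HC0 (2 * tau k) _); last by rewrite mulr_gt0.
    apply: le_lebesgue_rV => x [Ox /andP[_ d2]]; split => //.
    by apply: le_lt_trans d2 _; have := tau0 k; lra.
  apply: le_trans h1 _.
  apply: (@le_trans _ _ ((K * tau k `^ g)%:E * (f%:E * (C0 * (2 * tau k))%:E))%E).
    apply: lee_wpmul2l => //; apply: le_trans h2 _.
    by apply: lee_wpmul2l.
  rewrite -!EFinM lee_fin.
  rewrite /z -powR_exprn// -[B * _ * _]mulrA -powRM ?(ltW T0)//.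
  rewrite -/(tau k).
  have -> : tau k `^ om = tau k `^ g * tau k `^ r * tau k.
    rewrite /om powRD; last by rewrite (gt_eqF (tau0 k)) implybT.
    rewrite powRD; last by rewrite (gt_eqF (tau0 k)) implybT.
    by rewrite powRr1// ltW.
  by rewrite le_eqVlt; apply/orP; left; apply/eqP; rewrite /B /f; ring.
rewrite (ma_energy_bigcup oOmega bOmega Ox1 cont_u M_gt0 heq mF tF OF).
apply: (@le_lt_trans _ _ (B * T `^ om / (1 - z))%:E); last exact: ltry.
apply: lime_le.
  apply: is_cvg_nneseries => k _ _.
  have := ge_integral_ma oOmega bOmega Ox1 cont_u M_gt0 heq (mF k) (FO k) (lexx 0).
  by rewrite mul0e; apply => x _; exact: normr_ge0.
apply: nearW => N.
apply: (@le_trans _ _ (\sum_(0 <= k < N) (B * T `^ om * z ^+ k)%:E)%E).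
  by apply: lee_sum => k _; exact: term.
rewrite sumEFin lee_fin -mulr_sumr ler_wpM2l//.
  by rewrite mulr_ge0// powR_ge0.
have -> : \sum_(0 <= k < N) z ^+ k = (1 - z ^+ N) / (1 - z).
  elim: N => [|N IH]; first by rewrite big_geq// expr0 subrr mul0r.
  rewrite big_nat_recr//= IH exprS; field.
  by rewrite subr_eq0 eq_sym lt_eqF.
rewrite ler_pdivrMr ?subr_gt0// mulVf ?gerBl ?exprn_ge0 ?(ltW z0)//.
by rewrite subr_eq0 eq_sym lt_eqF.
Qed.

End UpperBound.

(** * Infinite energy near a flat boundary part *)

Section LowerBound.
Context {R : realType} {n : nat}.
Local Notation V := 'rV[R]_n.+1.
Local Notation bV := (borel_rV R n.+1).
Local Notation lam := (@lebesgue_rV R n.+1).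
Variable Omega : set V.
Hypothesis oOmega : open Omega.
Hypothesis cOmega : forall x y t, Omega x -> Omega y -> 0 <= t <= 1 ->
  Omega (t *: x + (1 - t) *: y).
Variable D : R.
Hypothesis bOmega : forall x, Omega x -> enorm x <= D.
Variable x1 : V.
Hypothesis Ox1 : Omega x1.
Local Notation bd := (boundary Omega).
Local Notation dist x := (euclid_dist x bd).
Implicit Types (x y q : V).

(** The hyperplane of [B] misses [Omega]: a point of [Omega] in it could be moved
    towards the centre [c] into the ball without leaving [Omega]. By convexity
    [Omega] then stays on one side of the hyperplane, which fixes the sign of the
    normal [e]. *)
Lemma flat_ball_normal (B : set V) : is_flat_ball B -> B `<=` bd ->
  exists e c r, [/\ enorm e = 1, 0 < r,
    (forall y, dotv (y - c) e = 0 -> enorm (y - c) < r -> bd y) &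
    forall x, Omega x -> 0 < dotv (x - c) e].
Proof.
move=> [_ [c [r [[a [b [a0 ->]]] /= cb r0 ->]]]] Bbd.
have an : 0 < enorm a by exact: enorm_gt0.
pose e0 := (enorm a)^-1 *: a.
have e01 : enorm e0 = 1.
  by rewrite enormZ gtr0_norm ?invr_gt0// mulVf// gt_eqF.
have flat y : dotv (y - c) e0 = 0 -> enorm (y - c) < r -> bd y.
  move=> ye yc; apply: Bbd; split => //=.
  move: ye; rewrite dotvZr => /eqP; rewrite mulf_eq0 invr_eq0 (gt_eqF an) /=.
  by rewrite dotvBl subr_eq0 => /eqP; rewrite dotvC => ->; rewrite dotvC.
have cbd : bd c by apply: flat; rewrite subrr ?dotv0l// enorm0.
have off x : Omega x -> dotv (x - c) e0 != 0.
  move=> Ox; apply/eqP => xe.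
  pose L := enorm (x - c) + 1.
  have L0 : 0 < L by rewrite ltr_wpDl ?enorm_ge0.
  pose t := Num.min 1 (r / L).
  have t0 : 0 < t by rewrite lt_min ltr01 divr_gt0.
  have t01 : 0 < t <= 1 by rewrite t0 ge_min lexx.
  have Oy := closure_interior_point oOmega cOmega cbd.1 Ox t01.
  have yE : t *: x + (1 - t) *: c - c = t *: (x - c).
    by apply/rowP => i; rewrite !mxE; ring.
  have /(boundaryE oOmega)[_] : bd (t *: x + (1 - t) *: c).
    apply: flat; rewrite yE; first by rewrite dotvZl xe mulr0.
    rewrite enormZ gtr0_norm//; apply: (@lt_le_trans _ _ (t * L)).
      by rewrite ltr_pM2l// /L ltrDl.
    by rewrite -ler_pdivlMr// ge_min lexx orbT.
  by [].
have oneside e : enorm e = 1 -> (forall x, Omega x -> dotv (x - c) e != 0) ->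
    0 < dotv (x1 - c) e -> forall x, Omega x -> 0 < dotv (x - c) e.
  move=> e1 offe s1 x Ox; rewrite ltNge; apply/negP => s.
  pose d := dotv (x1 - c) e - dotv (x - c) e.
  have d0 : 0 < d by rewrite /d; lra.
  pose t := dotv (x1 - c) e / d.
  have t01 : 0 <= t <= 1.
    by rewrite (divr_ge0 (ltW s1) (ltW d0)) ler_pdivrMr// mul1r /d; lra.
  have /eqP := offe _ (cOmega Ox Ox1 t01); apply.
  rewrite (_ : _ - c = t *: (x - c) + (1 - t) *: (x1 - c)); last first.
    by apply/rowP => i; rewrite !mxE; ring.
  rewrite dotvDl !dotvZl.
  have : t * d = dotv (x1 - c) e by rewrite /t divfK// gt_eqF.
  by rewrite /d; lra.
have [s1|s1] := ltP 0 (dotv (x1 - c) e0).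
  by exists e0, c, r; split => //; exact: oneside.
exists (- e0), c, r; split => //.
- by rewrite enormN.
- by move=> y; rewrite dotvNr => /eqP; rewrite oppr_eq0 => /eqP; exact: flat.
- apply: oneside; first by rewrite enormN.
    by move=> x Ox; rewrite dotvNr oppr_eq0 off.
  by rewrite dotvNr oppr_gt0 lt_neqAle s1 off.
Qed.

Variables (e c : V) (r : R).
Hypothesis e1 : enorm e = 1.
Hypothesis r0 : 0 < r.
Hypothesis flat : forall y, dotv (y - c) e = 0 -> enorm (y - c) < r -> bd y.
Hypothesis side : forall x, Omega x -> 0 < dotv (x - c) e.

(** A point [x] close to the flat part lies on the segment from [x1] to a boundary
    point [z] of the flat part, and the interior of that segment is in [Omega]. *)
Lemma flat_cylinder : exists h R0, [/\ 0 < h, 0 < R0, R0 < r &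
  forall x, 0 < dotv (x - c) e < h -> enorm (perp e (x - c)) < R0 -> Omega x].
Proof.
have s1 := side Ox1; set s := dotv (x1 - c) e in s1.
pose L := enorm (x1 - c); have L0 : 0 <= L by exact: enorm_ge0.
have sL : 0 < 1 + L / s by rewrite ltr_pwDl// divr_ge0// ltW.
pose h := Num.min (s / 2) (r / 8 / (1 + L / s)).
have rp := r0.
exists h, (r / 4); split; [|lra|lra|].
  by rewrite lt_min !divr_gt0.
move=> x /andP[x0 xh] xR.
set t := dotv (x - c) e in x0 xh.
have hs : h <= s / 2 by rewrite ge_min lexx.
have hr : h * (1 + L / s) <= r / 8.
  by rewrite -ler_pdivlMr// ge_min lexx orbT.
pose tau := t / s.
have tau0 : 0 < tau by rewrite divr_gt0.
have tau2 : tau <= 2^-1.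
  by rewrite ler_pdivrMr//; lra.
have tau1 : 0 < 1 - tau by lra.
pose z := (1 - tau)^-1 *: (x - tau *: x1).
have zc : z - c = (1 - tau)^-1 *: ((x - c) - tau *: (x1 - c)).
  by apply/rowP => i; rewrite !mxE; field; rewrite gt_eqF.
have bz : bd z.
  apply: flat; rewrite zc.
    rewrite dotvZl dotvBl dotvZl -/t -/s /tau divfK ?gt_eqF//.
    by rewrite subrr mulr0.
  rewrite enormZ gtr0_norm ?invr_gt0// ltr_pdivrMl//.
  apply: le_lt_trans (enormD _ _) _; rewrite enormN enormZ gtr0_norm// -/L.
  have h1 := enorm_le_perp e1 (x - c); rewrite -/t gtr0_norm// in h1.
  have h2 : t + tau * L < r / 8.
    apply: lt_le_trans hr; rewrite (_ : t + tau * L = t * (1 + L / s)).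
      by rewrite ltr_pM2r.
    by rewrite /tau; field; rewrite gt_eqF.
  have h3 : 2^-1 * r <= (1 - tau) * r by rewrite ler_wpM2r ?(ltW r0)//; lra.
  lra.
have -> : x = tau *: x1 + (1 - tau) *: z.
  by rewrite /z scalerA divff ?gt_eqF// scale1r addrC subrK.
apply: (closure_interior_point oOmega cOmega bz.1 Ox1).
by rewrite tau0; lra.
Qed.

Variable u : V -> R.
Hypothesis cont_u : {within closure Omega, continuous u}.
Hypothesis conv_u : forall x y t, Omega x -> Omega y -> 0 <= t <= 1 ->
  u (t *: x + (1 - t) *: y) <= t * u x + (1 - t) * u y.
Hypothesis bd_u : forall z, boundary Omega z -> u z = 0.
Hypothesis u_neg : forall x, Omega x -> u x < 0.
Variables (M p alpha : R).
Hypothesis M_gt0 : 0 < M.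
Hypothesis p_gt0 : 0 < p.
Hypothesis alpha_ge0 : 0 <= alpha.
Hypothesis heq : ma_equation Omega M p alpha u.
Local Notation ma := (monge_ampere Omega u).

Variables (h R0 : R).
Hypothesis h0 : 0 < h.
Hypothesis R00 : 0 < R0.
Hypothesis R0r : R0 < r.
Hypothesis Hcyl : forall x, 0 < dotv (x - c) e < h ->
  enorm (perp e (x - c)) < R0 -> Omega x.

Definition slab t : set V :=
  [set x | t <= dotv (x - c) e < 2 * t /\ enorm (perp e (x - c)) <= R0 / 2].

Lemma measurable_slab t : measurable (slab t : set bV).
Proof.
rewrite (_ : slab t = [set x | t <= dotv (x - c) e] `&`
  [set x | dotv (x - c) e < 2 * t] `&` [set x | enorm (perp e (x - c)) <= R0 / 2]).
  have cd : continuous (fun x => dotv (x - c) e).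
    apply: (@enorm_lip_continuous _ _ _ 1) => x y; rewrite mul1r -dotvBl.
    by rewrite opprB addrA subrK norm_dotv_unit_le.
  have cp : continuous (fun x => enorm (perp e (x - c))).
    apply: (@enorm_lip_continuous _ _ _ 1) => x y; rewrite mul1r.
    apply: le_trans (enorm_lip _ _) _; rewrite -perpB.
    by rewrite opprB addrA subrK enorm_perp_le.
  apply: measurableI; last exact: measurable_le_continuous.
  apply: measurableI; first exact: measurable_ge_continuous.
  exact: measurable_lt_continuous.
apply/seteqP; split => x /=; first by move=> [/andP[-> ->] ->].
by move=> [[h1 h2] h3]; split => //; rewrite h1.
Qed.

Lemma slabE t : slab t = [set x | cyl e t (R0 / 2) (x - (c + t *: e))].
Proof.
have xE x : x - (c + t *: e) = (x - c) - t *: e by rewrite opprD addrA.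
apply/seteqP; split => x; rewrite /slab /cyl /= xE; move: (x - c) => y;
  rewrite dotvBl dotvZl dotv_unit// mulr1 perpB perpZ perp_unit// scaler0 subr0;
  by rewrite subr_ge0 ltrBlDr (_ : 2 * t = t + t)// mulr2n mulrDl mul1r.
Qed.

Section slice.
Variable t : R.
Hypothesis t0 : 0 < t.
Hypothesis th : 3 * t <= h.
Let P := c + t *: e.
Let A := - u P.

Lemma dotv_P : dotv (P - c) e = t.
Proof. by rewrite /P addrAC subrr add0r dotvZl dotv_unit// mulr1. Qed.

Lemma perp_P : perp e (P - c) = 0.
Proof. by rewrite /P addrAC subrr add0r perpZ perp_unit// scaler0. Qed.

Lemma Omega_P : Omega P.
Proof.
have tp := t0; have th3 := th; apply: Hcyl; first by rewrite dotv_P t0; lra.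
by rewrite perp_P enorm0.
Qed.

Lemma A_gt0 : 0 < A.
Proof. by rewrite oppr_gt0; exact: u_neg Omega_P. Qed.

Lemma slab_Omega : slab t `<=` Omega.
Proof. have tp := t0; have th3 := th; have Rp := R00.
by move=> x [/andP[h1 h2] h3]; apply: Hcyl; [apply/andP; split|]; lra. Qed.

(** Harnack's inequality for the concave function [- u]: [P] and the points of
    the slab lie on segments in [Omega] on which they are well inside. *)
Lemma slab_harnack x : slab t x -> A / 4 <= - u x <= 4 * A.
Proof.
have tp := t0; have th3 := th; have Rp := R00.
move=> Sx; have [/andP[s1 s2] s3] := Sx; have Ox := slab_Omega Sx.
have q01 : 0 <= (4^-1 : R) <= 1 by apply/andP; split; lra.
apply/andP; split.
  pose y := (4 / 3) *: (x - 4^-1 *: P).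
  have yc : y - c = (4 / 3) *: ((x - c) - 4^-1 *: (P - c)).
    by apply/rowP => i; rewrite !mxE; field.
  have Oy : Omega y.
    apply: Hcyl; rewrite yc.
      by rewrite dotvZl dotvBl dotvZl dotv_P; apply/andP; split; lra.
    by rewrite perpZ perpB perpZ perp_P scaler0 subr0 enormZ ger0_norm; lra.
  have := conv_u Omega_P Oy q01; have := u_neg Oy.
  have -> : 4^-1 *: P + (1 - 4^-1) *: y = x.
    by apply/rowP => i; rewrite !mxE; field.
  by rewrite /A; lra.
pose y := (4 / 3) *: (P - 4^-1 *: x).
have yc : y - c = (4 / 3) *: ((P - c) - 4^-1 *: (x - c)).
  by apply/rowP => i; rewrite !mxE; field.
have Oy : Omega y.
  apply: Hcyl; rewrite yc.
    by rewrite dotvZl dotvBl dotvZl dotv_P; apply/andP; split; lra.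
  rewrite perpZ perpB perpZ perp_P sub0r -scalerN scalerA enormZ enormN ger0_norm; lra.
have := conv_u Ox Oy q01; have := u_neg Oy.
have -> : 4^-1 *: x + (1 - 4^-1) *: y = P.
  by apply/rowP => i; rewrite !mxE; field.
by rewrite /A; lra.
Qed.

(** From a point of the slab one can move by [t / 2] along the axis and by
    [R0 / 4] across it without leaving [Omega], and [u] cannot increase by more
    than [4 A] on the way; hence the two bounds on the slopes. *)
Lemma slab_subdifferential :
  \bigcup_(x in slab t `&` Omega) subdifferential Omega u x `<=`
  plate 0 e (8 * A / t) (16 * A / R0).
Proof.
have tp := t0; have th3 := th; have Rp := R00.
move=> q [x [Sx Ox] Hq]; have [/andP[s1 s2] s3] := Sx.
have /andP[_ ux] := slab_harnack Sx.
have slope v : Omega (x + v) -> dotv q v <= 4 * A.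
  move=> Ov; have := Hq _ Ov; rewrite addrAC subrr add0r.
  by have := u_neg Ov; lra.
rewrite /plate /= subr0; split.
  have t2 : 0 < t / 2 by lra.
  have O1 : Omega (x + (t / 2) *: e).
    apply: Hcyl; rewrite addrAC.
      rewrite dotvDl dotvZl dotv_unit// mulr1; apply/andP; split; lra.
    by rewrite perpD perpZ perp_unit// scaler0 addr0; lra.
  have O2 : Omega (x + (- (t / 2)) *: e).
    apply: Hcyl; rewrite addrAC.
      rewrite dotvDl dotvZl dotv_unit// mulr1; apply/andP; split; lra.
    by rewrite perpD perpZ perp_unit// scaler0 addr0; lra.
  have h1 := slope _ O1; have h2 := slope _ O2.
  rewrite !dotvZr in h1 h2.
  by rewrite ler_pdivlMr// -[X in _ * X]gtr0_norm// -normrM ler_norml;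
    apply/andP; split; lra.
have [->|v0] := eqVneq (perp e q) 0.
  by rewrite enorm0 divr_ge0 ?(ltW R00)// mulr_ge0// ltW// A_gt0.
have vn : 0 < enorm (perp e q) by exact: enorm_gt0.
pose rho := R0 / 4 / enorm (perp e q).
have rho0 : 0 < rho by rewrite !divr_gt0.
have ve : dotv (perp e q) e = 0 by exact: dotv_perp.
have vv : perp e (perp e q) = perp e q.
  by rewrite {1}/perp ve scale0r subr0.
have O1 : Omega (x + rho *: perp e q).
  apply: Hcyl; rewrite addrAC.
    by rewrite dotvDl dotvZl ve mulr0 addr0; apply/andP; split; lra.
  rewrite perpD perpZ vv; apply: le_lt_trans (enormD _ _) _.
  rewrite enormZ gtr0_norm// /rho divfK ?gt_eqF//; lra.
have := slope _ O1; rewrite dotvZr (dotv_splitE e1 q) ve mulr0 add0r vv -enormE.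
rewrite /rho mulrA divfK ?gt_eqF// => H.
by rewrite ler_pdivlMr//; lra.
Qed.

Lemma slab_dist x : slab t x -> dist x <= 2 * t.
Proof.
have tp := t0; have Rp := R00; have Rr := R0r.
move=> [/andP[s1 s2] s3]; apply: (@le_trans _ _ (dotv (x - c) e)); last exact: ltW.
pose z := x - dotv (x - c) e *: e.
have zc : z - c = perp e (x - c) by rewrite /z /perp addrAC.
have bz : bd z.
  apply: flat; rewrite zc; first exact: dotv_perp.
  by apply: le_lt_trans s3 _; lra.
apply: le_trans (dist_le _ bz) _.
rewrite /z opprD addrA subrr add0r opprK enormZ e1 mulr1 ger0_norm//; lra.
Qed.

Lemma slab_mass cl : 0 < cl ->
  (forall a b, 0 < a -> 0 < b -> ((cl * a * b ^+ n)%:E <= lam (cyl e a b))%E) ->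
  ((M * (A / 4) `^ p * (2 * t) `^ (- alpha) * (cl * t * (R0 / 2) ^+ n))%:E
    <= ma (slab t))%E.
Proof.
move=> cl0 Hcl; pose f := M * (A / 4) `^ p * (2 * t) `^ (- alpha).
have f0 : 0 <= f by rewrite !mulr_ge0 ?powR_ge0 ?(ltW M_gt0).
have A0 := A_gt0.
apply: (@le_trans _ _ (f%:E * lam (slab t))%E).
  rewrite [leLHS]EFinM; apply: lee_wpmul2l => //; rewrite slabE lebesgue_rV_translate.
  by apply: Hcl; rewrite ?divr_gt0.
apply: (monge_ampere_ge oOmega bOmega Ox1 cont_u heq (measurable_slab t)
  slab_Omega f0) => x Sx.
have Ox := slab_Omega Sx; have d0 := dist_gt0 oOmega bOmega Ox1 Ox.
have /andP[ux _] := slab_harnack Sx.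
rewrite /f -!mulrA ler_pM2l//; apply: ler_pM; rewrite ?powR_ge0//.
  apply: ge0_ler_powR; rewrite ?nnegrE ?(ltW p_gt0)//; first lra.
  by rewrite (ltr0_norm (u_neg Ox)).
rewrite !powRN lef_pV2 ?posrE ?powR_gt0// ?mulr_gt0//.
apply: ge0_ler_powR; rewrite ?nnegrE ?(ltW d0) ?mulr_ge0 ?(ltW t0)//.
exact: slab_dist.
Qed.

Lemma slab_image cu : 0 < cu ->
  (forall a b, 0 < a -> 0 < b -> (lam (cyl e a b) <= (cu * a * b ^+ n)%:E)%E) ->
  (ma (slab t) <= (cu * (3 * (8 * A / t)) * (16 * A / R0) ^+ n)%:E)%E.
Proof.
move=> cu0 Hcu; have A0 := A_gt0.
have k1 : 0 < 8 * A / t by rewrite divr_gt0// mulr_gt0.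
have k2 : 0 < 16 * A / R0 by rewrite divr_gt0// mulr_gt0.
have k3 : 0 < 3 * (8 * A / t) by rewrite mulr_gt0.
apply: le_trans (Hcu _ _ k3 k2).
rewrite -[leRHS](lebesgue_rV_translate (0 - (8 * A / t) *: e)).
apply: le_lebesgue_rV; apply: subset_trans slab_subdifferential _.
exact: plate_sub_cyl.
Qed.

End slice.

(** Comparing the mass of a slab at height [t] with the volume of its slopes
    gives [|u| >= k t^((2 - alpha) / (n + 1 - p))] there, so that the energy of
    the slab is bounded below by a multiple of a power of [t], whose exponent is
    nonpositive under the hypothesis on [p] and [alpha]. *)
Lemma slab_energy : alpha < 2 -> p - alpha <= (alpha - 1) * n.+1%:R - 2 ->
  exists2 k, 0 < k & forall t, 0 < t -> 3 * t <= h -> t <= 1 ->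
    (k%:E <= \int[ma]_(x in slab t) `|u x|%:E)%E.
Proof.
move=> al2 hpa.
have [cl [cu [cl0 cu0 Hvol]]] := @cyl_volume R n.
have Hcl a b : 0 < a -> 0 < b -> ((cl * a * b ^+ n)%:E <= lam (cyl e a b))%E.
  by move=> a0 b0; have /andP[] := Hvol e a b e1 a0 b0.
have Hcu a b : 0 < a -> 0 < b -> (lam (cyl e a b) <= (cu * a * b ^+ n)%:E)%E.
  by move=> a0 b0; have /andP[] := Hvol e a b e1 a0 b0.
pose N : R := n.+1%:R; have N0 : 0 < N by rewrite ltr0n.
have pN : 0 < N - p.
  have : (alpha - 1) * N <= 1 * N by rewrite ler_wpM2r ?(ltW N0)//; lra.
  by rewrite -/N in hpa; lra.
pose b1 := M * 4^-1 `^ p * 2 `^ (- alpha) * (cl * (R0 / 2) ^+ n).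
pose b2 := cu * 24 * (16 / R0) ^+ n.
have R2 : 0 < R0 / 2 by rewrite divr_gt0.
have b10 : 0 < b1 by rewrite !mulr_gt0 ?powR_gt0 ?exprn_gt0.
have R16 : 0 < 16 / R0 by rewrite divr_gt0.
have b20 : 0 < b2 by rewrite !mulr_gt0 ?exprn_gt0.
pose s := (p + 1) / (N - p).
have s0 : 0 < s by rewrite divr_gt0// addr_gt0.
pose k := 4^-1 * b1 * (b1 / b2) `^ s.
exists k; first exact: mulr_gt0 (mulr_gt0 (_ : 0 < 4^-1) b10) (powR_gt0 _ (divr_gt0 b10 b20)).
move=> t t0 th t1.
set A := - u (c + t *: e); have A0 : 0 < A := A_gt0 t0 th.
have massE : M * (A / 4) `^ p * (2 * t) `^ (- alpha) * (cl * t * (R0 / 2) ^+ n) =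
    b1 * (A `^ p * t `^ (1 - alpha)).
  rewrite powRM ?(ltW A0)// powRM ?(ltW t0)//.
  rewrite powRD ?(gt_eqF t0) ?implybT// powRr1 ?(ltW t0)//.
  by rewrite /b1; ring.
have mass := slab_mass t0 th cl0 Hcl; rewrite -/A massE in mass.
have growth : b1 * t `^ (2 - alpha) <= b2 * A `^ (N - p).
  have := le_trans mass (slab_image t0 th cu0 Hcu); rewrite -/A lee_fin => H.
  have AN : A `^ (N - p) * A `^ p = A * A ^+ n.
    rewrite -powRD ?(gt_eqF A0) ?implybT// subrK -exprS /N powR_mulrn//.
    exact: ltW.
  have tt : t `^ (2 - alpha) = t `^ (1 - alpha) * t.
    rewrite -[X in _ = _ * X](powRr1 (ltW t0)) -powRD ?(gt_eqF t0) ?implybT//.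
    by congr (_ `^ _); ring.
  rewrite -(ler_pM2r (powR_gt0 p A0)) tt.
  have -> : b2 * A `^ (N - p) * A `^ p = b2 * (A * A ^+ n) by rewrite -mulrA AN.
  have := ler_wpM2r (ltW t0) H.
  have -> : cu * (3 * (8 * A / t)) * (16 * A / R0) ^+ n * t = b2 * (A * A ^+ n).
    rewrite (_ : 16 * A / R0 = (16 / R0) * A); last by ring.
    by rewrite exprMn /b2; field; rewrite gt_eqF.
  by apply: le_trans; rewrite le_eqVlt; apply/orP; left; apply/eqP; ring.
have Alow : (b1 / b2) `^ s * t `^ ((2 - alpha) * s) <= A `^ (p + 1).
  have -> : A `^ (p + 1) = (A `^ (N - p)) `^ s.
    by rewrite -powRrM /s mulrC divfK// gt_eqF.
  have kp : 0 <= b1 / b2 by rewrite ltW// divr_gt0.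
  rewrite (powRrM t) -powRM ?powR_ge0//.
  have g1 : b1 / b2 * t `^ (2 - alpha) <= A `^ (N - p).
    by rewrite mulrAC ler_pdivrMr// [leRHS]mulrC.
  have g0 : 0 <= b1 / b2 * t `^ (2 - alpha) by rewrite mulr_ge0 ?powR_ge0.
  by apply: ge0_ler_powR g1; rewrite ?nnegrE ?powR_ge0 ?(ltW s0).
have expo : (2 - alpha) * s + (1 - alpha) <= 0.
  rewrite -(pmulr_lle0 _ pN) mulrDl.
  have -> : (2 - alpha) * s * (N - p) = (2 - alpha) * (p + 1).
    by rewrite -mulrA divfK// gt_eqF.
  by rewrite -/N in hpa; lra.
have tpow : 1 <= t `^ ((2 - alpha) * s + (1 - alpha)).
  rewrite -[leLHS](powRr0 t); apply: ger_powR => //.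
  by rewrite t0.
have A4 : 0 <= A / 4 by lra.
have h1 : ((A / 4)%:E * ma (slab t) <= \int[ma]_(x in slab t) `|u x|%:E)%E.
  apply: (ge_integral_ma oOmega bOmega Ox1 cont_u M_gt0 heq (measurable_slab t)
    (slab_Omega t0 th) A4) => x Sx.
  have /andP[h2 _] := slab_harnack t0 th Sx.
  by rewrite (ltr0_norm (u_neg (slab_Omega t0 th Sx))).
apply: le_trans h1; apply: le_trans (lee_wpmul2l _ mass); last by rewrite lee_fin.
rewrite -EFinM lee_fin.
have -> : A / 4 * (b1 * (A `^ p * t `^ (1 - alpha))) =
    4^-1 * b1 * (A `^ (p + 1) * t `^ (1 - alpha)).
  by rewrite powRD ?(gt_eqF A0) ?implybT// powRr1 ?(ltW A0)//; ring.
rewrite /k ler_pM2l; last by apply: mulr_gt0 b10; rewrite invr_gt0.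
apply: le_trans (ler_wpM2r (powR_ge0 t (1 - alpha)) Alow).
rewrite -[leRHS]mulrA -powRD ?(gt_eqF t0) ?implybT// ler_peMr ?powR_ge0//.
Qed.

(** The slabs at the heights [T 2^-j] are disjoint. *)
Lemma ma_energy_infinite : alpha < 2 -> p - alpha <= (alpha - 1) * n.+1%:R - 2 ->
  ma_energy Omega u = +oo%E.
Proof.
move=> al2 hpa; have [k k0 Hk] := slab_energy al2 hpa.
pose T := Num.min 1 (h / 3).
have T0 : 0 < T by rewrite lt_min ltr01 divr_gt0.
pose t j : R := T * 2^-1 ^+ j.
have t0 j : 0 < t j by rewrite mulr_gt0// exprn_gt0.
have tT j : t j <= T.
  by rewrite ler_piMr ?(ltW T0)// exprn_ile1//; lra.
have t1 j : t j <= 1 by rewrite (le_trans (tT j))// ge_min lexx.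
have th j : 3 * t j <= h.
  have : T <= h / 3 by rewrite ge_min lexx orbT.
  by have := tT j; lra.
have FO j : slab (t j) `<=` Omega := slab_Omega (t0 j) (th j).
have tF : trivIset setT (fun j => slab (t j) : set bV).
  have H i j x : (i < j)%N -> slab (t i) x -> slab (t j) x -> False.
    move=> ij [/andP[h1 _] _] [/andP[_ h2] _].
    have : t j <= t i.+1 by rewrite ler_pM2l// ler_wiXn2l//; lra.
    rewrite [t i.+1]/t exprSr mulrA -/(t i); lra.
  apply/trivIsetP => i j _ _ ij; apply/seteqP; split => x // -[Fi Fj].
  by move: ij; rewrite neq_ltn => /orP[] ij; [exact: (H i j x)|exact: (H j i x)].
have low m : ((m%:R * k)%:E <= ma_energy Omega u)%E.
  have := ma_energy_ge oOmega bOmega Ox1 cont_u M_gt0 heq m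
    (fun j => measurable_slab (t j)) tF FO.
  apply: le_trans.
  apply: (@le_trans _ _ (\sum_(0 <= j < m) k%:E)%E).
    rewrite sumEFin lee_fin big_const_nat iter_addr addr0 subn0.
    by rewrite mulr_natl.
  by apply: lee_sum => j _; exact: Hk.
apply/eqP; rewrite -leye_eq leNgt; apply/negP.
case E : (ma_energy Omega u) low => [x| |] low; last 2 first.
- by rewrite ltxx.
- by have := low 0%N; rewrite mul0r.
move=> _; have := low (Num.truncn (x / k)).+1; rewrite lee_fin leNgt => /negP; apply.
by rewrite -ltr_pdivrMr// truncnS_gt.
Qed.

End LowerBound.

(** * The dichotomy for the energy *)

Theorem theorem1p9 (R : realType) (n : nat) (Omega : set 'rV[R]_n)
    (alpha p M : R) (u : 'rV[R]_n -> R)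
    (hn : (2 <= n)%N)
    (hOmega : convex_domain Omega) (hbounded : bounded_set Omega)
    (halpha : 0 <= alpha < 2) (hp : 0 < p) (hM : 0 < M)
    (hcont : {within closure Omega, continuous u})
    (hnonzero : exists x, closure Omega x /\ u x != 0)
    (hconvex : @convex_function R 'rV[R]_n Omega u)
    (heq : ma_equation Omega M p alpha u)
    (hboundary : forall x, boundary Omega x -> u x = 0) :
  ((alpha - 1) * n%:R - 2 < p - alpha ->
    (ma_energy Omega u < +oo)%E) /\
  (p - alpha <= (alpha - 1) * n%:R - 2 ->
    (exists Gamma H B : set 'rV[R]_n,
      [/\ closed Gamma, Gamma `<=` boundary Omega,
          is_hyperplane H /\ Gamma `<=` H &
          is_flat_ball B /\ B `<=` Gamma]) ->
    ma_energy Omega u = +oo%E).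
Proof.
case: n => [//|n] in Omega u hn hOmega hbounded hcont hnonzero hconvex heq
  hboundary *.
have [oOmega [x1 Ox1] cvx] := hOmega.
have cOmega x y t : Omega x -> Omega y -> 0 <= t <= 1 ->
    Omega (t *: x + (1 - t) *: y).
  move=> Ox Oy /andP[t0 t1].
  by have := cvx x y (Itv01 t0 t1) (mem_set Ox) (mem_set Oy); rewrite inE.
have conv_u x y t : Omega x -> Omega y -> 0 <= t <= 1 ->
    u (t *: x + (1 - t) *: y) <= t * u x + (1 - t) * u y.
  move=> Ox Oy /andP[t0 t1].
  exact: (hconvex (Itv01 t0 t1) x y (mem_set Ox) (mem_set Oy)).
have [D bOmega] : exists D, forall x, Omega x -> enorm x <= D.
  have [B [_ HB]] := hbounded.
  exists (n.+1%:R * (B + 1)) => x Ox; apply: le_trans (enorm_le_norm x) _.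
  by rewrite ler_pM2l ?ltr0n//; apply: HB Ox; rewrite ltrDl.
split=> hpa.
  have [g [g0 ug hg]] := decay_supercritical oOmega cOmega bOmega Ox1 hcont
    conv_u hboundary hM hp heq halpha hpa.
  exact: (decay_energy_finite oOmega cOmega bOmega Ox1 hcont hM hp heq g0 ug hg).
have /andP[alpha0 alpha2] := halpha.
move=> [Gamma [_ [B [_ Gbd _ [flatB BG]]]]].
have [e [c [r [e1 r0 flat side]]]] :=
  flat_ball_normal oOmega cOmega Ox1 flatB (subset_trans BG Gbd).
have [h [R0 [h0 R00 R0r Hcyl]]] :=
  flat_cylinder oOmega cOmega Ox1 e1 r0 flat side.
have u_neg x : Omega x -> u x < 0.
  have [z [cz uz]] := hnonzero.
  by apply: (u_lt0 oOmega cOmega bOmega hcont conv_u hboundary); exists z.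
exact: (ma_energy_infinite oOmega bOmega Ox1 e1 flat hcont conv_u
  u_neg hM hp alpha0 heq h0 R00 R0r Hcyl alpha2 hpa).
Qed.
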